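(* Let $\mathbb{F}\in\{\mathbb{R},\mathbb{C}\}$, let $\sigma$ be the identity if $\mathbb{F}=\mathbb{R}$ and complex conjugation if $\mathbb{F}=\mathbb{C}$. Let $G$ be a split minimal Kac-Moody group over $\mathbb{F}$ with maximal torus $T$, let $\theta$ be a $\sigma$-twisted Cartan-Chevalley involution of $G$, let $K=\{g\in G\mid \theta(g)=g\}$, and let $A=\{t\,\theta(t)^{-1}\mid t\in T\}$. Then for each $\varepsilon\in\{+,-\}$ the map $$\mu_\varepsilon: K\times A\times U_\varepsilon\to G,\qquad (k,a,u)\mapsto kau$$ is a bijection.
   Context: $G$ is a split minimal Kac-Moody group of rank $n$ over $\mathbb{F}$, with Coxeter system $(W,S)$ ($W$ the Weyl group), root system $\Phi$, fundamental roots $\Pi=\{\alpha_1,\dots,\alpha_n\}$, positive/negative roots $\Phi_+,\Phi_-$, and root group datum $\{U_\alpha\}_{\alpha\in\Phi}$. $T=\bigcap_{\alpha\in\Phi}N_G(U_\alpha)$ is a maximal torus. $G$ is generated by $T$ and the root groups. For $\varepsilon\in\{+,-\}$, $U_\varepsilon=\langle U_\alpha\mid\alpha\in\Phi_\varepsilon\rangle$. Put $G_\alpha=\langle U_\alpha,U_{-\alpha}\rangle$; for $\alpha\in\Pi$ this is isomorphic to a central quotient of $\mathrm{SL}_2(\mathbb{F})$. A $\sigma$-twisted Cartan-Chevalley involution of $G$ is an automorphism that is conjugate under inner automorphisms to an involution $\theta\in\mathrm{Aut}(G)$ such that, for all $\alpha\in\Phi$, $\theta(U_\alpha)=U_{-\alpha}$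 and $\theta\circ\sigma$ induces a Cartan-Chevalley involution on $G_\alpha$; it is assumed throughout that $\theta$ itself has these two properties. The restriction of such a $\theta$ to $G_\alpha$ is induced by a map of $\mathrm{SL}_2(\mathbb{F})$ of the form $x\mapsto \mathrm{diag}(1,e)\,((x^\sigma)^T)^{-1}\,\mathrm{diag}(1,e^{-1})$, where $e\in\mathbb{F}$ satisfies $e^\sigma=e$ (here $T$ in the exponent denotes transpose), and $\theta$ is globally the product of a field automorphism, a sign automorphism and a diagonal automorphism; on the torus, $\theta(t)=\sigma(t)^{-1}$.
   Formalization: The Cartan-Chevalley condition on each G_α is taken with e > 0, not merely e^σ = e; for e < 0 the claim is false, e.g. e = −1 in SL_2(R) gives K = SO(1,1) and KAU_+ ≠ G. *)

(* Defs.v *)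
From HB Require Import structures.
From mathcomp Require Import all_boot all_order all_algebra.
From mathcomp Require Import boolp classical_sets functions reals.
From mathcomp.real_closed Require Import complex.

Set Implicit Arguments.
Unset Strict Implicit.
Unset Printing Implicit Defensive.

Import Order.TTheory GRing.Theory Num.Theory.

Local Open Scope ring_scope.
Local Open Scope classical_set_scope.

Inductive generated (G : groupType) (X : set G) : set G :=
| gen_in g : X g -> generated X g
| gen_one : generated X 1%g
| gen_mul g h : generated X g -> generated X h -> generated X (g * h)%g
| gen_inv g : generated X g -> generated X g^-1%g.

Definition is_subgroup (G : groupType) (H : set G) : Prop :=
  [/\ H 1%g, forall x y, H x -> H y -> H (x * y)%g & forall x, H x -> H x^-1%g].

Definition conj_set (G : groupType) (g : G) (X : set G) : set G :=
  [set (g * x * g^-1)%g | x in X].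

(* The lattice Lambda is Z^m and its dual is identified with Z^m by the standard
   pairing.  The simple roots [sroot i] and coroots [scoroot i] need not be
   linearly independent. *)
Definition pairing (R : pzRingType) (m : nat) (x y : 'rV[R]_m) : R :=
  \sum_(k < m) x 0 k * y 0 k.

Record km_datum (n m : nat) := KmDatum {
  gcm : 'M[int]_n;
  sroot : 'I_n -> 'rV[int]_m;
  scoroot : 'I_n -> 'rV[int]_m;
  gcm_diag : forall i, gcm i i = 2;
  gcm_offdiag : forall i j, i != j -> gcm i j <= 0;
  gcm_zero : forall i j, gcm i j = 0 -> gcm j i = 0;
  gcm_pairing : forall i j, pairing (sroot j) (scoroot i) = gcm i j
}.

Section Roots.
Variables (n m : nat) (D : km_datum n m).

(* Roots live in the free abelian group Z^n on the fundamental roots, so that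
   they stay distinct even if the [sroot i] are dependent. *)
Definition froot (i : 'I_n) : 'rV[int]_n := delta_mx 0 i.

Definition refl (i : 'I_n) (x : 'rV[int]_n) : 'rV[int]_n :=
  x - (\sum_(j < n) x 0 j * gcm D i j) *: froot i.

(* Elements of the Weyl group are represented by words in the generators. *)
Definition weyl (w : seq 'I_n) (x : 'rV[int]_n) : 'rV[int]_n := foldr refl x w.

Definition root_sys : set 'rV[int]_n := [set a | exists w i, a = weyl w (froot i)].

(* [true] stands for the sign +, [false] for the sign -. *)
Definition signed_roots (eps : bool) : set 'rV[int]_n :=
  [set a | root_sys a /\ forall i, 0 <= (-1) ^+ (~~ eps) * a 0 i].

Definition prenilpotent (a b : 'rV[int]_n) : Prop :=
  forall eps, exists w, signed_roots eps (weyl w a) /\ signed_roots eps (weyl w b).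

Definition open_interval (a b : 'rV[int]_n) : set 'rV[int]_n :=
  [set c | [/\ root_sys c, c <> a, c <> b &
    forall eps w, signed_roots eps (weyl w a) -> signed_roots eps (weyl w b) ->
      signed_roots eps (weyl w c)]].

End Roots.

(* [L] with bracket [br] is a Lie algebra in which [e], [f], [h] satisfy the
   defining relations of the Kac-Moody algebra of [D]; [h] embeds the coroot
   lattice tensored with F. *)
Record km_relations (F : fieldType) (n m : nat) (D : km_datum n m)
    (L : lmodType F) (br : L -> L -> L) (e f : 'I_n -> L)
    (h : {linear 'rV[F]_m -> L}) : Prop := KmRelations {
  br_linl : forall a x y z, br (a *: x + y) z = a *: br x z + br y z;
  br_linr : forall a x y z, br z (a *: x + y) = a *: br z x + br z y;
  br_alt : forall x, br x x = 0;
  br_jacobi : forall x y z, br x (br y z) + br y (br z x) + br z (br x y) = 0;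
  rel_hh : forall u v, br (h u) (h v) = 0;
  rel_he : forall u i, br (h u) (e i) = pairing (map_mx intr (sroot D i)) u *: e i;
  rel_hf : forall u i, br (h u) (f i) = - (pairing (map_mx intr (sroot D i)) u *: f i);
  rel_ef : forall i j,
    br (e i) (f j) = if i == j then h (map_mx intr (scoroot D i)) else 0;
  serre_e : forall i j, i != j -> iter `|1 - gcm D i j|%N (br (e i)) (e j) = 0;
  serre_f : forall i j, i != j -> iter `|1 - gcm D i j|%N (br (f i)) (f j) = 0
}.

(* The Lie algebra presented by these generators and relations. *)
Definition is_km_algebra (F : fieldType) (n m : nat) (D : km_datum n m)
    (L : lmodType F) (br : L -> L -> L) (e f : 'I_n -> L)
    (h : {linear 'rV[F]_m -> L}) : Prop :=
  km_relations D br e f h /\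
  forall (L' : lmodType F) (br' : L' -> L' -> L') (e' f' : 'I_n -> L')
      (h' : {linear 'rV[F]_m -> L'}),
    km_relations D br' e' f' h' ->
    exists! psi : {linear L -> L'},
      [/\ forall x y, psi (br x y) = br' (psi x) (psi y),
          forall i, psi (e i) = e' i, forall i, psi (f i) = f' i
        & forall u, psi (h u) = h' u].

(* [phi] is exp (ad x), for x acting locally nilpotently. *)
Definition is_exp_ad (F : fieldType) (L : lmodType F) (br : L -> L -> L)
    (x : L) (phi : L -> L) : Prop :=
  forall y, exists2 N, iter N (br x) y = 0 &
    phi y = \sum_(k < N) (k`!%:R)^-1 *: iter k (br x) y.

Definition mx2 (R : Type) (a b c d : R) : 'M[R]_2 :=
  \matrix_(i < 2, j < 2)
    if i == 0 then (if j == 0 then a else b) else (if j == 0 then c else d).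

(* The F-points of the split torus Hom(Lambda, F^x) are the rows with nonzero
   entries. *)
Definition torus_pt (F : fieldType) (m : nat) (t : 'rV[F]_m) : Prop :=
  forall k, t 0 k != 0.

Definition torus_mul (F : fieldType) (m : nat) (s t : 'rV[F]_m) : 'rV[F]_m :=
  \row_(k < m) (s 0 k * t 0 k).

Definition charval (F : fieldType) (m : nat) (t : 'rV[F]_m) (l : 'rV[int]_m) : F :=
  \prod_(k < m) t 0 k ^ l 0 k.

Definition cocharval (F : fieldType) (m : nat) (u : F) (l : 'rV[int]_m) : 'rV[F]_m :=
  \row_(k < m) u ^ l 0 k.

(* Tits' axioms for the adjoint action on the Kac-Moody algebra; [f i] has the
   sign for which [e i, f i] is the i-th coroot. *)
Definition has_adjoint_rep (F : fieldType) (G : groupType) (n m : nat)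
    (D : km_datum n m) (phi : 'I_n -> 'M[F]_2 -> G) (eta : 'rV[F]_m -> G) : Prop :=
  exists (L : lmodType F) (br : L -> L -> L) (e f : 'I_n -> L)
    (h : {linear 'rV[F]_m -> L}) (Ad : G -> {linear L -> L}),
  [/\ is_km_algebra D br e f h,
      [/\ forall x, Ad 1%g x = x,
          forall a b x, Ad (a * b)%g x = Ad a (Ad b x)
        & forall a x y, Ad a (br x y) = br (Ad a x) (Ad a y)],
      forall i r, is_exp_ad br (r *: e i) (Ad (phi i (mx2 1 r 0 1))) /\
                  is_exp_ad br (r *: f i) (Ad (phi i (mx2 1 0 r 1))),
      forall t, torus_pt t ->
        [/\ forall i, Ad (eta t) (e i) = charval t (sroot D i) *: e i,
            forall i, Ad (eta t) (f i) = charval t (- sroot D i) *: f i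
          & forall u, Ad (eta t) (h u) = h u]
    & forall a, (forall x, Ad a x = x) -> exists2 t, torus_pt t & a = eta t].

(* [phi i] is the standard homomorphism from SL_2(F) (the matrices of
   determinant 1; other values are irrelevant) and [U a] the root group of the
   real root [a] (values off the root system are irrelevant).  The fields from
   [U_pos] on say that the [U a] form a root group datum, which for the group
   attached by Tits to [D] is a theorem. *)
Record split_km (F : fieldType) (G : groupType) (n m : nat) (D : km_datum n m) :=
    SplitKm {
  phi : 'I_n -> 'M[F]_2 -> G;
  eta : 'rV[F]_m -> G;
  U : 'rV[int]_n -> set G;
  phiM : forall i x y, \det x = 1 -> \det y = 1 ->
    phi i (x *m y) = (phi i x * phi i y)%g;
  etaM : forall s t, torus_pt s -> torus_pt t ->
    eta (torus_mul s t) = (eta s * eta t)%g;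
  eta_inj : forall s t, torus_pt s -> torus_pt t -> eta s = eta t -> s = t;
  phi_diag : forall i u, u != 0 ->
    phi i (mx2 u 0 0 u^-1) = eta (cocharval u (scoroot D i));
  adjoint : has_adjoint_rep D phi eta;
  U_pos : forall i, U (froot i) = [set phi i (mx2 1 r 0 1) | r in [set: F]];
  U_neg : forall i, U (- froot i) = [set phi i (mx2 1 0 r 1) | r in [set: F]];
  U_subgroup : forall a, root_sys D a -> is_subgroup (U a);
  U_nontrivial : forall a, root_sys D a -> U a <> [set 1%g];
  U_comm : forall a b, root_sys D a -> root_sys D b -> a <> b ->
    prenilpotent D a b -> forall x y, U a x -> U b y ->
    generated (\bigcup_(c in open_interval D a b) U c) [~ x, y]%g;
  U_refl : forall i x, U (froot i) x -> x <> 1%g ->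
    exists y z, [/\ U (- froot i) y, U (- froot i) z &
      forall b, root_sys D b -> conj_set (y * x * z)%g (U b) = U (refl D i b)];
  U_proper : forall i,
    ~ (U (- froot i) `<=` generated (\bigcup_(a in signed_roots D true) U a));
  eta_image : [set eta t | t in [set t : 'rV[F]_m | torus_pt t]] =
    [set g | forall a, root_sys D a -> conj_set g (U a) = U a];
  G_generated : generated
    ([set eta t | t in [set t : 'rV[F]_m | torus_pt t]] `|`
     \bigcup_(a in root_sys D) U a) = [set: G]
}.

Section SplitKm.
Variables (F : fieldType) (G : groupType) (n m : nat) (D : km_datum n m).
Variable X : split_km F G D.

Definition torus : set G :=
  [set g | forall a, root_sys D a -> conj_set g (U X a) = U X a].

Definition Usgn (eps : bool) : set G :=
  generated (\bigcup_(a in signed_roots D eps) U X a).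

Definition weyl_lift (w : seq 'I_n) : G :=
  (\prod_(i <- w) phi X i (mx2 0 1 (-1) 0)%R)%g.

(* For a = weyl w (froot i), the map SL_2(F) -> G with image <U_a, U_{-a}>; all
   the choices of (w, i) for a given root a differ at most by conjugation by
   diag(1, -1). *)
Definition pinning (w : seq 'I_n) (i : 'I_n) (x : 'M[F]_2) : G :=
  (weyl_lift w * phi X i x * (weyl_lift w)^-1)%g.

Record field_automorphism (sigma : F -> F) (s : G -> G) : Prop := FieldAut {
  field_autM : {morph s : x y / (x * y)%g};
  field_aut_phi : forall i x, \det x = 1 -> s (phi X i x) = phi X i (map_mx sigma x);
  field_aut_eta : forall t, torus_pt t -> s (eta X t) = eta X (map_mx sigma t)
}.

End SplitKm.

(* Inverse transpose, up to a positive rescaling of the root vectors.  In the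
   order of R[i], [0 < e] entails that e is real, hence fixed by conjugation.
   For e < 0 the fixed points would be a noncompact form such as SO(1,1) or
   SU(1,1), which has no Iwasawa decomposition. *)
Definition cartan_chevalley_on (F : numFieldType) (G : groupType)
    (pin : 'M[F]_2 -> G) (theta : G -> G) : Prop :=
  exists2 e : F, 0 < e & forall x, \det x = 1 ->
    theta (pin x) = pin (mx2 1 0 0 e *m invmx x^T *m mx2 1 0 0 e^-1).

Record twisted_cartan_chevalley (F : numFieldType) (G : groupType) (n m : nat)
    (D : km_datum n m) (X : split_km F G D) (sigma : F -> F) (theta : G -> G) :
    Prop := TwistedCartanChevalley {
  thetaM : {morph theta : x y / (x * y)%g};
  thetaK : involutive theta;
  theta_U : forall a, root_sys D a -> theta @` U X a = U X (- a);
  theta_sigma : exists2 s : G -> G, field_automorphism X sigma s &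
    (forall w i, cartan_chevalley_on (pinning X w i) (theta \o s)) /\
    (forall t, torus X t -> theta t = (s t)^-1%g)
}.

Inductive ground := RealField | ComplexField.

Definition ground_field (R : realType) (k : ground) : numFieldType :=
  match k with RealField => R | ComplexField => R[i] end.

Definition ground_conj (R : realType) (k : ground) :
    ground_field R k -> ground_field R k :=
  match k with RealField => id | ComplexField => @conjc R end.

(* Main.v *)
(* With B = T U_+, the Iwasawa decomposition of SL_2 gives G_i B = K_i B for every
   fundamental root, and since G is generated by T and the G_i this yields G = K B;
   the polar decomposition of T then gives G = K A U_+. If k a u = k' a' u', then
   v = u' u^-1 satisfies theta(v) in T U_+, so uniqueness reduces to the triviality
   of the intersection of U_+ with T U_-.

   The latter is proved by a covering argument. U_+ acts on the building G / T U_-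
   of chambers, and the stabilizer of w B_- contains the group U_(w) generated by the
   finitely many U_b with b > 0 and w^-1 b < 0. The cosets of the U_(w) in U_+ form a
   connected covering of the building, to which the actions of the rank one groups
   SL_2 lift. The images of the points (1, w) under the lifts that fix the base
   point form a section closed under adjacency, hence the whole covering. So the
   covering is trivial over the base chamber, where its fibre is the intersection
   of U_+ with T U_-. The case of U_- follows from that of U_+ by applying theta. *)
Require Import Defs.
From mathcomp Require Import all_boot all_order all_algebra.
From mathcomp Require Import boolp classical_sets functions reals.
From mathcomp.real_closed Require Import complex.
From mathcomp Require Import zify ring.

Set Implicit Arguments.
Unset Strict Implicit.
Unset Printing Implicit Defensive.

Import Order.TTheory GRing.Theory Num.Theory.

Local Open Scope ring_scope.
Local Open Scope classical_set_scope.

(** * Positivity of real roots *)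

(** The axiom [U_proper] only forbids that a single root group [U (- froot i)] lie in $U_+$; the
    triviality of the whole intersection of $U_+$ with $TU_-$ has to be built up from it. Two
    obstacles shape the argument. When $W$ is infinite, two positive roots need not be prenilpotent,
    so nothing says directly that $U_{\alpha_i}$ normalizes the group generated by the other
    positive root groups. The unipotent radical of a minimal parabolic is therefore closed up by
    force under conjugation by the i-th $\mathrm{SL}_2$; it stays inside $U_+$ because, for each
    positive $b\neq\alpha_i$, at least one of the pairs $(\alpha_i,b)$ and $(-\alpha_i,b)$ is
    prenilpotent. Secondly, the stabilizer of $wB_-$ in $U_+$ is not known to be $U_{(w)}$; the
    covering measures the difference. The rank one groups are lifted to it one at a time and no
    relation between the lifts for different $i$ is ever checked. It suffices that each lift
    preserves adjacency and lies over a left translation by an element of $G$. *)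

Section Weyl.
Variables (n m : nat) (D : km_datum n m).
Implicit Types (i j s t : 'I_n) (x y : 'rV[int]_n) (u v w : seq 'I_n).

Local Notation refl := (Defs.refl D).
Local Notation weyl := (Defs.weyl D).
Local Notation al := (@Defs.froot n).

Definition copair i x : int := \sum_(j < n) x 0 j * gcm D i j.

Lemma copairP i (c : int) x y : copair i (c *: x + y) = c * copair i x + copair i y.
Proof.
rewrite /copair mulr_sumr -big_split /=; apply: eq_bigr => j _.
by rewrite !mxE mulrDl mulrA.
Qed.

Lemma copairP' i (c : int) x y : copair i (x + c *: y) = copair i x + c * copair i y.
Proof. by rewrite addrC copairP addrC. Qed.

Lemma copair_froot i j : copair i (al j) = gcm D i j.
Proof.
rewrite /copair (bigD1 j) //= big1 => [|k kj]; first by rewrite !mxE !eqxx mul1r addr0.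
by rewrite !mxE (negPf kj) /= mul0r.
Qed.

Lemma reflE i x : refl i x = x - copair i x *: al i.
Proof. by []. Qed.

Lemma refl_lin i c x y : refl i (c *: x + y) = c *: refl i x + refl i y.
Proof.
rewrite !reflE copairP scalerDl scalerBr opprD addrACA; congr (_ + _ + _).
by rewrite scalerA.
Qed.

Lemma weyl_lin w c x y : weyl w (c *: x + y) = c *: weyl w x + weyl w y.
Proof. by elim: w => //= i w ->; rewrite refl_lin. Qed.

Lemma weylD w x y : weyl w (x + y) = weyl w x + weyl w y.
Proof. by rewrite -[x in LHS]scale1r weyl_lin scale1r. Qed.

Lemma weyl0 w : weyl w 0 = 0.
Proof. by apply: (addrI (weyl w 0)); rewrite -weylD !addr0. Qed.

Lemma weylZ w c x : weyl w (c *: x) = c *: weyl w x.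
Proof. by rewrite -[c *: x]addr0 weyl_lin weyl0 addr0. Qed.

Lemma weylN w x : weyl w (- x) = - weyl w x.
Proof. by rewrite -scaleN1r weylZ scaleN1r. Qed.

Lemma refl_froot i : refl i (al i) = - al i.
Proof. by rewrite reflE copair_froot gcm_diag scaler_nat opprD addrA subrr sub0r. Qed.

Lemma reflK i : involutive (refl i).
Proof.
move=> x; rewrite [refl i x]reflE -scaleNr addrC refl_lin refl_froot reflE.
by rewrite scaleNr scalerN opprK addrC subrK.
Qed.

Lemma weyl_cat u v x : weyl (u ++ v) x = weyl u (weyl v x).
Proof. by rewrite /Defs.weyl foldr_cat. Qed.

Lemma weyl_rcons w i x : weyl (rcons w i) x = weyl w (refl i x).
Proof. by rewrite -cats1 weyl_cat. Qed.

Lemma weylK w : cancel (weyl w) (weyl (rev w)).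
Proof. by elim: w => // i w IH x; rewrite rev_cons weyl_rcons /= reflK IH. Qed.

Lemma weylVK w : cancel (weyl (rev w)) (weyl w).
Proof. by move=> x; rewrite -{1}(revK w) weylK. Qed.

Lemma weyl_inj w : injective (weyl w).
Proof. exact: can_inj (weylK w). Qed.

Lemma weyl_rev_ext u v : weyl u =1 weyl v -> weyl (rev u) =1 weyl (rev v).
Proof. by move=> uv x; apply: (@weyl_inj u); rewrite weylVK uv weylVK. Qed.

Definition nonneg x := forall j, 0 <= x 0 j.

Lemma nonneg_froot i : nonneg (al i).
Proof. by move=> j; rewrite mxE ler0n. Qed.

Lemma nonnegD x y : nonneg x -> nonneg y -> nonneg (x + y).
Proof. by move=> hx hy j; rewrite mxE addr_ge0. Qed.

Lemma nonnegZ c x : 0 <= c -> nonneg x -> nonneg (c *: x).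
Proof. by move=> hc hx j; rewrite mxE mulr_ge0. Qed.

(* The alternating word of length k in s and t whose last letter is t. *)
Fixpoint alt s t k : seq 'I_n := if k is k'.+1 then rcons (alt t s k') t else [::].

Lemma size_alt s t k : size (alt s t k) = k.
Proof. by elim: k s t => //= k IH s t; rewrite size_rcons IH. Qed.

Lemma alt_suffix s t k l : exists2 p, size p = k & alt s t (k + l) = p ++ alt s t l.
Proof.
elim: l s t => [|l IH] s t; first by exists (alt s t k); rewrite ?size_alt ?addn0 ?cats0.
have [p pk pE] := IH t s; exists p => //.
by rewrite addnS /= pE rcons_cat.
Qed.

Lemma refl0 i : refl i 0 = 0.
Proof. exact: (weyl0 [:: i]). Qed.

Lemma reflN i x : refl i (- x) = - refl i x.
Proof. exact: (weylN [:: i]). Qed.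

Lemma refl_comb s t c d :
  refl t (c *: al s + d *: al t) = c *: al s + (- d - c * gcm D t s) *: al t.
Proof.
rewrite refl_lin [refl t (al s)]reflE copair_froot.
have -> : refl t (d *: al t) = - d *: al t.
  by rewrite -[_ *: _]addr0 refl_lin refl_froot scalerN scaleNr refl0 addr0.
by rewrite scalerBr -addrA scalerA -scaleNr -scalerDl addrC [- d - _]addrC -addrC.
Qed.

(** The last hypothesis says that reflecting in t does not lower the coefficient of [al t]. Since
    the product of the two Cartan integers is at least 4, the new pair satisfies the same inequality
    with s and t exchanged. *)
Lemma alt_pos_inf s t k (c d : int) : s != t -> 4 <= gcm D s t * gcm D t s ->
  0 <= c -> 0 <= d -> 2 * d <= - gcm D t s * c ->
  exists c' d', [/\ 0 <= c', 0 <= d' &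
    weyl (alt s t k) (c *: al s + d *: al t) = c' *: al s + d' *: al t].
Proof.
elim: k s t c d => [|k IH] s t c d st st4 c0 d0 dc; first by exists c, d.
rewrite /= weyl_rcons refl_comb addrC.
have a0 := gcm_offdiag D st.
have b0 : gcm D t s <= 0 by apply: gcm_offdiag; rewrite eq_sym.
have ts4 : 4 <= gcm D t s * gcm D s t by rewrite mulrC.
have ts : t != s by rewrite eq_sym.
have h1 : 0 <= - d - c * gcm D t s by lia.
have h2 : 2 * c <= - gcm D s t * (- d - c * gcm D t s).
  have hA : 0 <= - gcm D s t * (- gcm D t s * c - 2 * d) by apply: mulr_ge0; lia.
  have hB : 0 <= (gcm D s t * gcm D t s - 4) * c by apply: mulr_ge0; lia.
  lia.
have [d' [c' [e1 e2 ->]]] := IH t s (- d - c * gcm D t s) c ts ts4 h1 c0 h2.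
by exists c', d'; rewrite addrC.
Qed.

(** The dihedral group of s and t keeps x fixed modulo [al s] and [al t], so its action can be
    followed on the two integers A and B alone. *)
Definition shift s t x (A B : int) := x - A *: al s - B *: al t.

Lemma refl_shiftr s t x (A B : int) :
  refl t (shift s t x A B) = shift s t x A (copair t x - A * gcm D t s - B).
Proof.
rewrite reflE /shift.
have -> : copair t (x - A *: al s - B *: al t) = copair t x - A * gcm D t s - B * 2.
  by rewrite -!scaleNr !copairP' !copair_froot gcm_diag; ring.
rewrite -addrA -opprD -scalerDl; congr (_ - _ *: _); ring.
Qed.

Lemma refl_shiftl s t x (A B : int) :
  refl s (shift s t x A B) = shift s t x (copair s x - B * gcm D s t - A) B.
Proof. by rewrite /shift addrAC (refl_shiftr t s) /shift addrAC. Qed.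

(* The finite crystallographic dihedral types, with the order of the product of
   the two reflections first. *)
Definition dihedral_types : seq (nat * int * int) :=
  [:: (2%N, 0, 0); (3%N, -1, -1); (4%N, -1, -2); (4%N, -2, -1); (6%N, -1, -3);
      (6%N, -3, -1)].

(** In each finite type both sides give coefficients that are linear in the two pairings of x, so
    the relation is an identity of polynomials. *)
Lemma braid s t (k : nat) : s != t ->
  (k, gcm D s t, gcm D t s) \in dihedral_types ->
  weyl (alt s t k) =1 weyl (alt t s k).
Proof.
move=> st H x.
have E : x = shift s t x 0 0 by rewrite /shift !scale0r !subr0.
move: H; rewrite /dihedral_types !inE => /or4P[|||/or3P[||]] /eqP[-> h1 h2];
rewrite /= [in LHS]E [in RHS]E !(refl_shiftl, refl_shiftr) h1 h2;
move: (copair s x) (copair t x) => p q; congr (shift s t x _ _); ring.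
Qed.

Lemma alt_pos_fin s t (k l : nat) : s != t -> (k < l)%N ->
  (l, gcm D s t, gcm D t s) \in dihedral_types ->
  exists c d, [/\ 0 <= c, 0 <= d & weyl (alt s t k) (al s) = c *: al s + d *: al t].
Proof.
move=> st kl H.
pose cmb c d := c *: al s + d *: al t.
have E : al s = cmb 1 0 by rewrite /cmb scale1r scale0r addr0.
have Ct c d : refl t (cmb c d) = cmb c (- d - c * gcm D t s) by exact: refl_comb.
have Cs c d : refl s (cmb c d) = cmb (- c - d * gcm D s t) d.
  by rewrite /cmb addrC refl_comb addrC.
suff [c [d [c0 d0 kE]]] : exists c d, [/\ 0 <= c, 0 <= d &
    weyl (alt s t k) (cmb 1 0) = cmb c d] by exists c, d; rewrite {1}E.
move: (cmb) Cs Ct {E} H kl => {}cmb Cs Ct.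
rewrite !inE => /or4P[|||/or3P[||]] /eqP[-> h1 h2];
rewrite h1 h2 in Cs Ct;
move: k => [|[|[|[|[|[|k]]]]]] // _;
by do 2 eexists; split; last (rewrite /= ?(Cs, Ct); reflexivity).
Qed.

(** If the product of the Cartan integers is at least 4, all coefficients stay nonnegative.
    Otherwise the type is one of the finite ones, of order l: for k < l the coefficients are
    computed, and for k >= l the braid relation makes the word end in s, which cancels the appended
    s. *)
Lemma alt_pos s t k : s != t ->
  (exists c d, [/\ 0 <= c, 0 <= d & weyl (alt s t k) (al s) = c *: al s + d *: al t]) \/
  exists2 u, (size u < k)%N & weyl u =1 weyl (rcons (alt s t k) s).
Proof.
move=> st; have ts : t != s by rewrite eq_sym.
have a0 := gcm_offdiag D st; have b0 := gcm_offdiag D ts.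
have [h4|h4] := leP 4 (gcm D s t * gcm D t s).
  left; have h : 2 * (0 : int) <= - gcm D t s * 1 by lia.
  have [c [d [c0 d0 E]]] := @alt_pos_inf s t k 1 0 st h4 isT isT h.
  by exists c, d; split=> //; rewrite -E scale1r scale0r addr0.
have ab : gcm D s t = 0 -> gcm D t s = 0 by apply: gcm_zero.
have ba : gcm D t s = 0 -> gcm D s t = 0 by apply: gcm_zero.
have [l H] : exists l : nat, (l, gcm D s t, gcm D t s) \in dihedral_types.
  have : (gcm D s t == 0) && (gcm D t s == 0) || (gcm D s t == -1) && (gcm D t s == -1)
     || (gcm D s t == -1) && (gcm D t s == -2) || (gcm D s t == -2) && (gcm D t s == -1)
     || (gcm D s t == -1) && (gcm D t s == -3) || (gcm D s t == -3) && (gcm D t s == -1).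
    have [a0'|an] := eqVneq (gcm D s t) 0; first by rewrite (ab a0').
    have [b0'|bn] := eqVneq (gcm D t s) 0; first by rewrite (ba b0') eqxx in an.
    have hA : 0 <= - gcm D s t * (- gcm D t s - 1) by apply: mulr_ge0; lia.
    have hB : 0 <= - gcm D t s * (- gcm D s t - 1) by apply: mulr_ge0; lia.
    have [hs ht] : -4 < gcm D s t /\ -4 < gcm D t s by split; lia.
    have : (gcm D s t == -1) || (gcm D s t == -2) || (gcm D s t == -3) by lia.
    by case/orP => [/orP[]|] /eqP e; rewrite e in h4 *; lia.
  case/orP => [/orP[/orP[/orP[/orP[|]|]|]|]|] /andP[/eqP -> /eqP ->];
  [exists 2%N|exists 3%N|exists 4%N|exists 4%N|exists 6%N|exists 6%N]; by [].
have [kl|lk] := ltnP k l; first by left; apply: alt_pos_fin kl H.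
right; have [p pk pE] := alt_suffix s t (k - l) l.
rewrite subnK // in pE.
have l0 : (0 < l)%N.
  by move: H; rewrite /dihedral_types !inE => /or4P[|||/or3P[||]] /eqP[-> _ _].
exists (p ++ alt s t l.-1).
  by rewrite size_cat size_alt pk; lia.
move=> x; rewrite weyl_rcons pE !weyl_cat (braid st H); congr (weyl p _).
by case: (l) l0 => // l' _; rewrite /= weyl_rcons reflK.
Qed.

Definition reduced w := forall w', weyl w' =1 weyl w -> (size w <= size w')%N.

(** A word in two letters that does not alternate has two equal neighbours, and these cancel. *)
Lemma alt_or_short s t u : {subset u <= [:: s; t]} ->
  [\/ u = alt s t (size u), u = alt t s (size u)
    | exists2 u', (size u' < size u)%N & weyl u' =1 weyl u].
Proof.
elim/last_ind: u => [|u c IH] su; first by constructor 1.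
have {}IH := IH (fun r ru => su r (mem_subseq (subseq_rcons u c) ru)).
have : c \in [:: s; t] by apply: su; rewrite mem_rcons mem_head.
have short d k : u = alt d c k.+1 ->
    exists2 u', (size u' < size (rcons u c))%N & weyl u' =1 weyl (rcons u c).
  move=> ->; exists (alt c d k); first by rewrite size_rcons !size_alt; lia.
  by move=> x; rewrite /= !weyl_rcons reflK.
have long (u' : seq 'I_n) : (size u' < size u)%N -> weyl u' =1 weyl u ->
    exists2 v, (size v < size (rcons u c))%N & weyl v =1 weyl (rcons u c).
  move=> h E; exists (rcons u' c); first by rewrite !size_rcons.
  by move=> x; rewrite !weyl_rcons E.
rewrite size_rcons in short long *.
rewrite !inE => /orP[] /eqP cE; subst c.
- case: IH => [uE|uE|[u' u'u E]]; last by constructor 3; apply: long E.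
  + by constructor 2; rewrite /= -uE.
  + case sE: (size u) uE => [|k] uE; first by constructor 2; rewrite uE.
    by rewrite -sE; constructor 3; apply: short uE.
- case: IH => [uE|uE|[u' u'u E]]; last by constructor 3; apply: long E.
  + case sE: (size u) uE => [|k] uE; first by constructor 1; rewrite uE.
    by rewrite -sE; constructor 3; apply: short uE.
  + by constructor 1; rewrite /= -uE.
Qed.

(* Humphreys, Reflection Groups and Coxeter Groups, Theorem 5.4: split off from
   w a longest final part u in the dihedral group of s and the last letter of w. *)
Lemma reduced_pos w s : reduced w ->
  (forall w', weyl w' =1 weyl (rcons w s) -> (size w <= size w')%N) ->
  nonneg (weyl w (al s)).
Proof.
have [N wN] := ubnP (size w); elim: N w s wN => // N IH w s wN rw lw.
case: (lastP w) => [|w0 t] in rw lw wN *; first exact: nonneg_froot.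
have st : s != t.
  apply/eqP => st; have /negP[] : ~~ (size (rcons w0 t) <= size w0)%N.
    by rewrite size_rcons ltnn.
  by apply: lw => x; rewrite !weyl_rcons st reflK.
clear w; set w := rcons w0 t in rw lw wN *.
(* Choosing the factorization with v shortest makes v minimal in its coset of the dihedral group; it
   starts from the factorization [w0 ++ [:: t]], which gives the strict decrease needed by the
   induction. *)
pose P k := `[< exists v u, [/\ size v = k, {subset u <= [:: s; t]},
  (size v + size u = size w)%N & weyl (v ++ u) =1 weyl w] >].
have P0 : P (size w0).
  apply/asboolP; exists w0, [:: t]; split=> //.
  - by move=> c; rewrite !inE => ->; rewrite orbT.
  - by rewrite size_rcons addn1.
  - by move=> x; rewrite cats1.
have exP : exists k, P k by exists (size w0).
case: (ex_minnP exP) => k /asboolP[v [u [vk su sz E]]] kmin.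
have kw : (size v < size w)%N by rewrite vk size_rcons ltnS kmin.
have rv : reduced v.
  move=> w' Ew'; have := rw (w' ++ u); rewrite size_cat -sz leq_add2r; apply=> x.
  by rewrite weyl_cat Ew' -weyl_cat.
(* If the product of v and c were shorter, c could be moved from v into u, against the minimality of
   v. *)
have lv c : c \in [:: s; t] ->
    forall w', weyl w' =1 weyl (rcons v c) -> (size v <= size w')%N.
  move=> cst w' Ew'; rewrite leqNgt; apply/negP => w'v.
  have Ew x : weyl (w' ++ c :: u) x = weyl w x.
    by rewrite weyl_cat Ew' weyl_rcons /= reflK -weyl_cat.
  have := rw _ Ew; rewrite size_cat /= => h.
  have /kmin : P (size w'); last by rewrite leqNgt -vk w'v.
  apply/asboolP; exists w', (c :: u); split=> //; last by rewrite /=; lia.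
  by move=> d; rewrite inE => /orP[/eqP ->|/su].
have vN : (size v < N)%N by apply: leq_trans kw _.
have vs : nonneg (weyl v (al s)).
  by apply: IH => //; apply: lv; rewrite mem_head.
have vt : nonneg (weyl v (al t)).
  by apply: IH => //; apply: lv; rewrite !inE eqxx orbT.
(* A nonempty alternating u ending in s is impossible: deleting that s would give a word for w
   followed by s that is shorter than w. *)
have uE : u = alt s t (size u).
  have [//|uE|[u' u'u Eu']] := alt_or_short su.
  - case: (size u) uE sz => [|l] uE sz; first by rewrite uE.
    have := lw (v ++ alt s t l); rewrite size_cat size_alt => h.
    suff : (size w <= size v + l)%N by lia.
    by apply: h => x; rewrite weyl_rcons -E uE /= !weyl_cat weyl_rcons reflK.
  - have := rw (v ++ u'); rewrite size_cat => h.
    suff : (size w <= size v + size u')%N by lia.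
    by apply: h => x; rewrite weyl_cat Eu' -weyl_cat.
rewrite -E weyl_cat {1}uE.
have [[c [d [c0 d0 ->]]]|[u' u'u Eu']] := alt_pos (size u) st.
  by rewrite weylD !weylZ; apply: nonnegD; apply: nonnegZ.
have := lw (v ++ u'); rewrite size_cat => h.
suff : (size w <= size v + size u')%N by lia.
by apply: h => x; rewrite weyl_cat Eu' -uE weyl_rcons [RHS]weyl_rcons -E weyl_cat.
Qed.

Lemma reducedP w : exists2 w', reduced w' & weyl w' =1 weyl w.
Proof.
pose P k := `[< exists2 v, size v = k & weyl v =1 weyl w >].
have exP : exists k, P k by exists (size w); apply/asboolP; exists w.
case: (ex_minnP exP) => k /asboolP[v vk E] kmin; exists v => // v' E'.
by rewrite vk; apply: kmin; apply/asboolP; exists v' => // x; rewrite E' E.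
Qed.

(** One of w and w followed by s has length at most that of the other, and [reduced_pos] applies to
    it; exchanging the two changes the sign of the root. *)
Lemma weyl_froot_sign w s : nonneg (weyl w (al s)) \/ nonneg (- weyl w (al s)).
Proof.
have [w0 rw0 E] := reducedP w; rewrite -E.
have [w1 rw1 E1] := reducedP (rcons w0 s).
have [le|lt] := leqP (size w0) (size w1).
  by left; apply: reduced_pos => // w' E'; apply: leq_trans le _; apply: rw1 => x; rewrite E' E1.
right; have -> : - weyl w0 (al s) = weyl w1 (al s).
  by rewrite E1 weyl_rcons refl_froot weylN.
apply: reduced_pos => // w' E'; apply: leq_trans (ltnW lt) _; apply: rw0 => x.
by rewrite E' weyl_rcons E1 weyl_rcons reflK.
Qed.

Lemma froot_neq0 s : al s <> 0.
Proof. by move=> /rowP/(_ s)/eqP; rewrite !mxE !eqxx. Qed.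

Lemma weyl_froot_neq0 w s : weyl w (al s) <> 0.
Proof. by rewrite -(weyl0 w) => /weyl_inj/froot_neq0. Qed.

Lemma nonneg_anti x : nonneg x -> nonneg (- x) -> x = 0.
Proof.
move=> h1 h2; apply/rowP => j; rewrite mxE; apply/eqP; rewrite eq_le h1 andbT.
by have := h2 j; rewrite mxE oppr_ge0.
Qed.

(** The last letter t of a nonempty reduced word sends [al t] to a negative root. *)
Lemma weyl_pos_id w : (forall s, nonneg (weyl w (al s))) -> weyl w =1 id.
Proof.
have [w0 rw0 E] := reducedP w => pos x; rewrite -E.
case: (lastP w0) => [|w1 t] in rw0 E *; first by [].
case: (@weyl_froot_neq0 w1 t); apply: nonneg_anti; last first.
  by rewrite -weylN -refl_froot -weyl_rcons E.
apply: reduced_pos => [w' E'|w' E']; last first.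
  by apply: leq_trans (rw0 _ E'); rewrite size_rcons.
have := rw0 (rcons w' t); rewrite !size_rcons ltnS; apply=> y.
by rewrite !weyl_rcons E'.
Qed.

End Weyl.

(** * Positive and negative roots, inversion sets *)

Section Roots.
Variables (n m : nat) (D : km_datum n m).
Implicit Types (i j : 'I_n) (a b c : 'rV[int]_n) (w : seq 'I_n).

Local Notation refl := (Defs.refl D).
Local Notation weyl := (Defs.weyl D).
Local Notation al := (@Defs.froot n).
Local Notation root := (root_sys D).
Local Notation pos := (signed_roots D true).
Local Notation neg := (signed_roots D false).

Lemma posE b : pos b <-> root b /\ nonneg b.
Proof.
by split=> -[rb h]; split=> // j; have := h j; rewrite /= expr0 mul1r.
Qed.

Lemma negE b : neg b <-> root b /\ nonneg (- b).
Proof.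
by split=> -[rb h]; split=> // j; have := h j; rewrite /= expr1 mulN1r mxE.
Qed.

Lemma root_al i : root (al i).
Proof. by exists [::], i. Qed.

Lemma root_weyl w b : root b -> root (weyl w b).
Proof. by move=> [v [i ->]]; exists (w ++ v), i; rewrite weyl_cat. Qed.

Lemma root_refl i b : root b -> root (refl i b).
Proof. exact: (@root_weyl [:: i]). Qed.

Lemma root_opp b : root b -> root (- b).
Proof.
by move=> [w [i ->]]; exists (rcons w i), i; rewrite weyl_rcons refl_froot weylN.
Qed.

Lemma root_sign b : root b -> pos b \/ neg b.
Proof.
move=> rb; have [w [i bE]] := rb.
by case: (weyl_froot_sign D w i); rewrite -bE => h; [left; apply/posE|right; apply/negE].
Qed.

Lemma pos_neg b : pos b -> neg b -> False.
Proof.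
move=> /posE[[w [i ->]] h] /negE[_ h'].
by apply: (@weyl_froot_neq0 _ _ D w i); apply: nonneg_anti.
Qed.

Lemma pos_root b : pos b -> root b. Proof. by case. Qed.
Lemma pos_al i : pos (al i).
Proof. by apply/posE; split; [exact: root_al|exact: nonneg_froot]. Qed.

Lemma neg_opp b : pos b -> neg (- b).
Proof. by move=> /posE[rb h]; apply/negE; rewrite opprK; split=> //; apply: root_opp. Qed.

Lemma pos_opp b : neg b -> pos (- b).
Proof. by move=> /negE[rb h]; apply/posE; split=> //; apply: root_opp. Qed.

(** The reflection changes only the i-th coordinate, so a positive root that it makes negative is a
    multiple of [al i]. *)
Lemma refl_pos i b : pos b -> b <> al i -> pos (refl i b).
Proof.
move=> /posE[rb hb] bi; have rr := root_refl i rb.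
case: (root_sign rr) => // /negE[_ h]; case: bi.
have b0 j : j != i -> b 0 j = 0.
  move=> ji; apply/eqP; rewrite eq_le hb andbT.
  have := h j; rewrite reflE !mxE eqxx /= (negPf ji) mulr0 subr0.
  by rewrite oppr_ge0.
have bE : b = b 0 i *: al i.
  apply/rowP => j; rewrite !mxE eqxx /=.
  by have [->|ji] := eqVneq j i; [rewrite mulr1|rewrite mulr0 b0].
suff -> : al i = b by [].
(* The multiple is 1: transporting b back to a fundamental root writes 1, the k-th coordinate of
   [al k], as [b 0 i] times an integer. *)
have [w [k bw]] := rb.
have /rowP/(_ k) : al k = b 0 i *: weyl (rev w) (al i).
  by rewrite -weylZ -bE bw weylK.
rewrite !mxE !eqxx /= => e; rewrite [RHS]bE.
suff -> : b 0 i = 1 by rewrite scale1r.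
have := hb i; move: e; move: (b 0 i) (weyl _ _ _ _) => p z pz p0.
have z1 : 1 <= z.
  by rewrite leNgt; apply/negP => z1; have := mulr_ge0 p0 (_ : 0 <= - z); lia.
have : 0 <= (z - 1) * p by apply: mulr_ge0; lia.
by have [p00|] := eqVneq p 0; [rewrite p00 mul0r in pz|lia].

Qed.

Lemma refl_neg i b : neg b -> b <> - al i -> neg (refl i b).
Proof.
move=> nb bi; rewrite -[b]opprK reflN; apply: neg_opp; apply: refl_pos.
  exact: pos_opp.
by move=> e; apply: bi; rewrite -e opprK.
Qed.

Lemma weylP (w : seq 'I_n) : ~ (weyl w =1 id) -> exists i, neg (weyl w (al i)).
Proof.
move=> h; apply: contrapT => h'; apply: h; apply: weyl_pos_id => i.
case: (root_sign (root_weyl w (root_al i))) => [/posE[]//|h].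
by case: h'; exists i.
Qed.

(* The composite below adds a multiple of al j to every fundamental root, hence
   keeps all of them positive. *)
Lemma weyl_refl w i j x : weyl w (al j) = al i ->
  weyl w (refl j x) = refl i (weyl w x).
Proof.
move=> wji; have wij : weyl (rev w) (al i) = al j by rewrite -wji weylK.
pose u := rev w ++ i :: rcons w j.
have uE y : weyl u y = weyl (rev w) (refl i (weyl w (refl j y))).
  by rewrite /u weyl_cat /= weyl_rcons.
suff u1 : weyl u =1 id by apply: (can_inj (reflK D i)); rewrite reflK -[in RHS](u1 x) uE weylVK.
apply: weyl_pos_id => k.
have [->|kj] := eqVneq k j.
  by rewrite uE refl_froot weylN wji reflN refl_froot opprK wij; exact: nonneg_froot.
case: (root_sign (root_weyl u (root_al k))) => [/posE[]//|/negE[_ /(_ k)]].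
rewrite uE [refl j _]reflE -scaleNr addrC weyl_lin wji refl_lin refl_froot reflE.
rewrite weylD weylZ weylN weylD weylN weylZ weylK wij !mxE eqxx /= eqxx (negPf kj).
by rewrite !mulr0 ?oppr0 ?mulr0 add0r ?subr0.
Qed.

Lemma refl_weyl_rev w i j x : weyl w (al j) = al i ->
  weyl (rev w) (refl i x) = refl j (weyl (rev w) x).
Proof. by move=> wji; rewrite -{1}(weylVK D w x) -(weyl_refl _ wji) weylK. Qed.

Definition inversions w : set 'rV[int]_n := [set b | pos b /\ neg (weyl (rev w) b)].

End Roots.

(** * Matrices in SL_2 *)

Section SL2.
Variable F : fieldType.
Implicit Types (a b c d r u : F) (g h : 'M[F]_2).

Definition up r : 'M[F]_2 := mx2 1 r 0 1.
Definition lo r : 'M[F]_2 := mx2 1 0 r 1.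
Definition dg u : 'M[F]_2 := mx2 u 0 0 u^-1.
Definition nn : 'M[F]_2 := mx2 0 1 (-1) 0.

Lemma mx2P g : g = mx2 (g 0 0) (g 0 1) (g 1 0) (g 1 1).
Proof.
by apply/matrixP => -[[|[|//]] p] [[|[|//]] q]; rewrite !mxE /=; congr (g _ _); apply: val_inj.
Qed.

Lemma mx2M a b c d a' b' c' d' : mx2 a b c d *m mx2 a' b' c' d' =
  mx2 (a * a' + b * c') (a * b' + b * d') (c * a' + d * c') (c * b' + d * d').
Proof.
apply/matrixP => -[[|[|//]] p] [[|[|//]] q];
by rewrite !mxE !big_ord_recl big_ord0 !mxE addr0.
Qed.

Lemma det_mx2 a b c d : \det (mx2 a b c d) = a * d - b * c.
Proof.
rewrite (expand_det_row _ 0) !big_ord_recl big_ord0 /cofactor !det_mx11 !mxE /=.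
by rewrite addr0 expr0 expr1 mul1r mulN1r mulrN.
Qed.

Lemma mx2_1 : mx2 1 0 0 1 = 1%:M :> 'M[F]_2.
Proof. by apply/matrixP => -[[|[|//]] p] [[|[|//]] q]; rewrite !mxE. Qed.

Lemma mx2T a b c d : (mx2 a b c d)^T = mx2 a c b d.
Proof. by apply/matrixP => -[[|[|//]] p] [[|[|//]] q]; rewrite !mxE. Qed.

Lemma det1M g h : \det g = 1 -> \det h = 1 -> \det (g *m h) = 1.
Proof. by rewrite det_mulmx => -> ->; rewrite mulr1. Qed.

Lemma det1_unit g : \det g = 1 -> g \in unitmx.
Proof. by rewrite unitmxE => ->; rewrite unitr1. Qed.

Lemma det1V g : \det g = 1 -> \det (invmx g) = 1.
Proof. by rewrite det_inv => ->; rewrite invr1. Qed.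

Lemma invmx_det1M g h : \det g = 1 -> \det h = 1 -> invmx (g *m h) = invmx h *m invmx g.
Proof.
move=> /det1_unit ug /det1_unit uh; rewrite -[RHS]mul1mx.
have ugh : g *m h \in unitmx by rewrite unitmx_mul ug.
by rewrite -(mulVmx ugh) -!mulmxA mulKVmx // mulmxV // mulmx1.
Qed.

Lemma invmx_mx2 a b c d : a * d - b * c = 1 -> invmx (mx2 a b c d) = mx2 d (- b) (- c) a.
Proof.
move=> e; have u : mx2 a b c d \in unitmx by apply: det1_unit; rewrite det_mx2.
rewrite -[LHS]mulmx1; have -> : 1%:M = mx2 a b c d *m mx2 d (- b) (- c) a.
  by rewrite mx2M -mx2_1; congr mx2; rewrite -?e; ring.
by rewrite mulKmx.
Qed.

Lemma det_up r : \det (up r) = 1. Proof. by rewrite det_mx2; ring. Qed.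
Lemma det_lo r : \det (lo r) = 1. Proof. by rewrite det_mx2; ring. Qed.
Lemma det_nn : \det nn = 1. Proof. by rewrite det_mx2; ring. Qed.
Lemma det_dg u : u != 0 -> \det (dg u) = 1.
Proof. by move=> u0; rewrite det_mx2 mulfV // mul0r subr0. Qed.

Lemma up0 : up 0 = 1%:M. Proof. exact: mx2_1. Qed.
Lemma lo0 : lo 0 = 1%:M. Proof. exact: mx2_1. Qed.
Lemma upD r s : up (r + s) = up r *m up s.
Proof. by rewrite mx2M; congr mx2; ring. Qed.
Lemma loD r s : lo (r + s) = lo r *m lo s.
Proof. by rewrite mx2M; congr mx2; ring. Qed.
Lemma invmx_up r : invmx (up r) = up (- r).
Proof. by rewrite invmx_mx2 ?oppr0 //; ring. Qed.
Lemma invmx_lo r : invmx (lo r) = lo (- r).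
Proof. by rewrite invmx_mx2 ?oppr0 //; ring. Qed.
Lemma invmx_nn : invmx nn = mx2 0 (-1) 1 0.
Proof. by rewrite invmx_mx2 ?opprK //; ring. Qed.

Lemma dg_lo u r : u != 0 -> dg u *m lo r *m invmx (dg u) = lo (u ^- 2 * r).
Proof.
move=> u0; rewrite invmx_mx2 ?mulfV // ?mulr0 ?subr0 // !mx2M.
by congr mx2; rewrite ?oppr0; field.
Qed.

Lemma nn_up r : nn *m up r *m invmx nn = lo (- r).
Proof. by rewrite invmx_nn !mx2M; congr mx2; ring. Qed.

Lemma nn_lo r : nn *m lo r *m invmx nn = up (- r).
Proof. by rewrite invmx_nn !mx2M; congr mx2; ring. Qed.

Lemma nnE : nn = up 1 *m lo (-1) *m up 1.
Proof. by rewrite !mx2M; congr mx2; ring. Qed.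

Definition lower g := \det g = 1 /\ g 0 1 = 0.

Lemma lowerE g : lower g <-> exists u r, u != 0 /\ g = lo r *m dg u.
Proof.
split=> [[dg1 g01]|[u [r [u0 ->]]]]; last first.
  by split; [by rewrite det_mulmx det_lo det_dg ?mulr1|rewrite mx2M !mxE /=; ring].
move: dg1 g01; rewrite (mx2P g) det_mx2 [mx2 _ _ _ _ 0 1]mxE /=.
move: (g 0 0) (g 0 1) (g 1 0) (g 1 1) => a b c d e b0.
have ad : a * d = 1 by rewrite -e b0 mul0r subr0.
have a0 : a != 0 by apply/eqP => a0; move/eqP: ad; rewrite a0 mul0r eq_sym oner_eq0.
have -> : d = a^-1 by rewrite -[d](mulKf a0) ad mulr1.
by exists a, (c / a); split=> //; rewrite mx2M b0; congr mx2; field.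
Qed.

Lemma lowerM g h : lower g -> lower h -> lower (g *m h).
Proof.
move=> [dg1 g01] [dh h01]; split; first exact: det1M.
by rewrite mxE !big_ord_recl big_ord0 /= h01 (_ : lift ord0 ord0 = 1) ?g01 ?h01;
  [ring|apply: val_inj].
Qed.

Lemma lowerV g : lower g -> lower (invmx g).
Proof.
move=> [dg1 g01]; split; first exact: det1V.
rewrite (mx2P g) invmx_mx2 ?mxE /= ?g01 ?oppr0 //.
by rewrite -g01 -det_mx2 -mx2P.
Qed.

Lemma lower1 : lower 1%:M.
Proof. by split; rewrite ?det1 ?mxE. Qed.

Lemma lower_lo r : lower (lo r).
Proof. by split; rewrite ?det_lo // mxE. Qed.

Lemma up_lower r : lower (up r) -> r = 0.
Proof. by move=> [_]; rewrite mxE. Qed.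

Lemma lower_nn r : ~ lower (up r *m nn).
Proof.
move=> [_]; rewrite mx2M mxE /= => /eqP.
by rewrite mul1r mulr0 addr0 oner_eq0.
Qed.

(** The cells are taken with respect to opposite Borel subgroups, upper unipotent on the left and
    lower triangular on the right; the entry [g 1 1] is zero exactly on the cell of [nn]. *)
Lemma bruhat g : \det g = 1 ->
  exists (r : F) (h : 'M[F]_2), lower h /\ (g = up r *m h \/ g = up r *m nn *m h).
Proof.
rewrite (mx2P g) det_mx2.
move: (g 0 0) (g 0 1) (g 1 0) (g 1 1) => a b c d e.
have [d0|d0] := eqVneq d 0.
  exists 0, (mx2 (- c) 0 a b); split.
    by split; [rewrite det_mx2 -e d0; ring|rewrite mxE].
  by right; rewrite up0 mul1mx mx2M d0; congr mx2; ring.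
exists (b / d), (mx2 (a - b * c / d) 0 c d); split.
  split; [rewrite det_mx2 -e; by field|by rewrite mxE].
by left; rewrite mx2M; congr mx2; field.
Qed.

End SL2.
Arguments nn {F}.

Ltac det1 := repeat first [ assumption | apply: det_up | apply: det_lo | apply: det_nn
  | apply: det_dg | apply: det1M | apply: det1V
  | match goal with H : lower ?g |- \det ?g = _ => exact (proj1 H) end ].
#[export] Hint Extern 0 (@eq _ (determinant _) _) => solve [det1] : core.

(** * Conjugation and generated subgroups *)

Section Conjugation.
Variable G : groupType.
Implicit Types (g h x y : G) (S T : set G).
Local Open Scope group_scope.

Definition cj g x := g * x * g^-1.

Lemma cjM g x y : cj g (x * y) = cj g x * cj g y.
Proof. by rewrite /cj !mulgA mulgVK. Qed.

Lemma cjA g h x : cj (g * h) x = cj g (cj h x).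
Proof. by rewrite /cj invgM !mulgA. Qed.

Lemma cj1 x : cj 1 x = x.
Proof. by rewrite /cj mul1g invg1 mulg1. Qed.

Lemma cjg1 g : cj g 1 = 1.
Proof. by rewrite /cj mulg1 mulgV. Qed.

Lemma cjV g x : cj g x^-1 = (cj g x)^-1.
Proof. by rewrite /cj !invgM invgK mulgA. Qed.

Lemma cjK g x : cj g^-1 (cj g x) = x.
Proof. by rewrite -cjA mulVg cj1. Qed.

Lemma cjVK g x : cj g (cj g^-1 x) = x.
Proof. by rewrite -cjA mulgV cj1. Qed.

Lemma mul_cj g x : g * x = cj g x * g.
Proof. by rewrite /cj mulgVK. Qed.

Lemma conj_setE g S T : conj_set g S = T ->
  (forall x, S x -> T (cj g x)) /\ (forall y, T y -> S (cj g^-1 y)).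
Proof.
move=> <-; split=> [x Sx|_ [x Sx <-]]; first by exists x.
by rewrite -/(cj g x) cjK.
Qed.

Lemma conj_set_eq g S T : (forall x, S x -> T (cj g x)) ->
  (forall y, T y -> S (cj g^-1 y)) -> conj_set g S = T.
Proof.
move=> h1 h2; apply/seteqP; split=> [_ [x Sx <-]|y Ty]; first exact: h1.
by exists (cj g^-1 y); [exact: h2|rewrite -/(cj g _) cjVK].
Qed.

Lemma gen_min S T : is_subgroup T -> S `<=` T -> generated S `<=` T.
Proof.
move=> [T1 TM TV] h x; elim=> {x} [x||x y _ hx _ hy|x _ hx] //; [exact: h|exact: TM|exact: TV].
Qed.

Lemma gen_group S : is_subgroup (generated S).
Proof.
by split; [exact: gen_one|move=> x y; exact: gen_mul|move=> x; exact: gen_inv].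
Qed.

Lemma gen_cj g S T : (forall x, S x -> generated T (cj g x)) ->
  forall x, generated S x -> generated T (cj g x).
Proof.
move=> h x; elim=> {x} [x||x y _ hx _ hy|x _ hx]; [exact: h| | |].
- by rewrite cjg1; exact: gen_one.
- by rewrite cjM; exact: gen_mul.
- by rewrite cjV; exact: gen_inv.
Qed.

End Conjugation.

(** * Root groups and minimal parabolic subgroups *)

Section KacMoodyGroup.
Variables (F : numFieldType) (G : groupType) (n m : nat) (D : km_datum n m).
Variable X : split_km F G D.
Implicit Types (i j : 'I_n) (a b c : 'rV[int]_n) (v w : seq 'I_n) (x y z : G).
Implicit Types (r s t : F) (S : set G) (g h : 'M[F]_2).

Local Notation refl := (Defs.refl D).
Local Notation weyl := (Defs.weyl D).
Local Notation al := (@Defs.froot n).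
Local Notation root := (root_sys D).
Local Notation pos := (signed_roots D true).
Local Notation neg := (signed_roots D false).
Local Notation Upos := (Usgn X true).
Local Notation Uneg := (Usgn X false).
Local Notation phi := (Defs.phi X).
Local Notation torus := (torus X).
Local Notation U := (Defs.U X).
Local Notation lift := (weyl_lift X).
Local Open Scope group_scope.

Definition genU (Psi : set 'rV[int]_n) : set G := generated (\bigcup_(b in Psi) U b).

Lemma genU_in (Psi : set 'rV[int]_n) b x : Psi b -> U b x -> genU Psi x.
Proof. by move=> pb ux; apply: gen_in; exists b. Qed.

Lemma genU_group Psi : is_subgroup (genU Psi).
Proof. exact: gen_group. Qed.

Lemma genU_min (Psi : set 'rV[int]_n) S : is_subgroup S ->
  (forall b x, Psi b -> U b x -> S x) -> genU Psi `<=` S.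
Proof. by move=> gS h; apply: gen_min => // x [b pb ux]; apply: h ux. Qed.

Lemma genU_sub (Psi Psi' : set 'rV[int]_n) : Psi `<=` Psi' -> genU Psi `<=` genU Psi'.
Proof.
by move=> h; apply: genU_min => [|b x /h]; [exact: genU_group|exact: genU_in].
Qed.

Lemma genU_cj (Psi Psi' : set 'rV[int]_n) (g : G) :
  (forall b x, Psi b -> U b x -> genU Psi' (cj g x)) ->
  forall x, genU Psi x -> genU Psi' (cj g x).
Proof. by move=> h; apply: gen_cj => x [b pb ux]; apply: h ux. Qed.

Lemma U_group b : root b -> is_subgroup (U b).
Proof. exact: U_subgroup. Qed.

Lemma phi1 i : phi i 1%:M = 1.
Proof.
by apply: (@mulgI _ (phi i 1%:M)); rewrite -phiM ?det1 // mulmx1 mulg1.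
Qed.

Lemma phiV i (h : 'M[F]_2) : \det h = 1%R -> phi i (invmx h) = (phi i h)^-1.
Proof.
move=> dh; apply: (@mulgI _ (phi i h)); rewrite -phiM ?det1V //.
by rewrite mulmxV ?det1_unit // phi1 mulgV.
Qed.

Lemma phi_cj i (h k : 'M[F]_2) : \det h = 1%R -> \det k = 1%R ->
  cj (phi i h) (phi i k) = phi i (h *m k *m invmx h).
Proof. by move=> dh dk; rewrite /cj !phiM ?phiV //; det1. Qed.

Lemma U_alP i x : U (al i) x <-> exists r, x = phi i (up r).
Proof.
by rewrite U_pos; split=> [[r _ <-]|[r ->]]; exists r.
Qed.

Lemma U_NalP i x : U (- al i) x <-> exists r, x = phi i (lo r).
Proof.
by rewrite U_neg; split=> [[r _ <-]|[r ->]]; exists r.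
Qed.

Lemma torus1 : torus 1.
Proof. by move=> a ra; apply: conj_set_eq => x; rewrite ?invg1 cj1. Qed.

Lemma torusM x y : torus x -> torus y -> torus (x * y).
Proof.
move=> tx ty a ra.
have [x1 x2] := conj_setE (tx a ra); have [y1 y2] := conj_setE (ty a ra).
apply: conj_set_eq => z; first by rewrite cjA => /y1/x1.
by rewrite invgM cjA => /x2/y2.
Qed.

Lemma torusV x : torus x -> torus x^-1.
Proof.
by move=> tx a ra; have [x1 x2] := conj_setE (tx a ra); apply: conj_set_eq; rewrite ?invgK.
Qed.

Lemma torusP x : torus x <-> exists2 t, torus_pt t & x = eta X t.
Proof.
have e := eta_image X; split=> [tx|[t pt ->]].
  have : [set g | forall a, root a -> conj_set g (U a) = U a] x by [].
  by rewrite -e => -[t pt <-]; exists t.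
have : [set eta X t | t in [set t | torus_pt t]] (eta X t) by exists t.
by rewrite e.
Qed.

Lemma torus_U (g : G) b x : torus g -> root b -> U b x -> U b (cj g x).
Proof. by move=> tg rb; apply: (conj_setE (tg b rb)).1. Qed.

Lemma phi_dg i r : r != 0%R -> torus (phi i (dg r)).
Proof.
move=> r0; rewrite phi_diag //; apply/torusP; exists (cocharval r (scoroot D i)) => //.
by move=> k; rewrite mxE expfz_neq0.
Qed.

Lemma torus_genU (g : G) (Psi : set 'rV[int]_n) : torus g -> Psi `<=` root ->
  forall x, genU Psi x -> genU Psi (cj g x).
Proof.
by move=> tg h; apply: genU_cj => b x pb ux; apply: (genU_in pb); apply: torus_U => //; apply: h.
Qed.

Lemma torus_Usgn (g : G) eps : torus g -> forall x, Usgn X eps x -> Usgn X eps (cj g x).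
Proof. by move=> tg; apply: torus_genU => // b []. Qed.

(* In characteristic 0 every scalar is a difference of two squares, so the
   rank one torus generates a whole root group from any of its nontrivial elements. *)
Lemma diff_squares r : exists s t, r = (s ^+ 2 - t ^+ 2)%R.
Proof.
exists ((r + 1) / 2)%R, ((r - 1) / 2)%R; field.
by [].
Qed.

Lemma lo_span i S r : is_subgroup S ->
  (forall u x, u != 0%R -> S x -> S (cj (phi i (dg u)) x)) ->
  r != 0%R -> S (phi i (lo r)) -> U (- al i) `<=` S.
Proof.
move=> [S1 SM SV] Sd r0 Sr _ /U_NalP[c ->].
have sq s : S (phi i (lo (s ^+ 2 * r)%R)).
  have [->|s0] := eqVneq s 0%R; first by rewrite expr0n mul0r lo0 phi1.
  rewrite -[s]invrK exprVn -dg_lo ?invr_neq0 // -phi_cj ?det_dg ?invr_neq0 //.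
  by apply: Sd; rewrite ?invr_neq0.
have [s [t e]] := diff_squares (c / r)%R.
have -> : c = (s ^+ 2 * r + - (t ^+ 2 * r))%R by rewrite -mulrBl -e divfK.
by rewrite loD phiM // -invmx_lo phiV //; apply: SM => //; apply: SV.
Qed.

(** This sharpens [U_proper] from non-inclusion to trivial intersection: by [lo_span], one
    nontrivial element of the root group would bring in all of it. *)
Lemma phi_lo_Upos i r : Upos (phi i (lo r)) -> r = 0%R.
Proof.
move=> h; apply: contrapT => /eqP r0; apply: (U_proper (s0 := X) (i := i)).
apply: lo_span r0 h; first exact: genU_group.
by move=> u x u0; apply: torus_Usgn; apply: phi_dg.
Qed.

Lemma U_al_neq i : U (al i) <> U (- al i).
Proof.
move=> e; apply: (U_proper (s0 := X) (i := i)); rewrite -e => x ux.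
by apply: genU_in ux; apply: pos_al.
Qed.

Lemma conj_up i r : conj_set (phi i (up r)) (U (al i)) = U (al i).
Proof.
apply: conj_set_eq => _ /U_alP[t ->]; apply/U_alP; exists t.
  by rewrite phi_cj // invmx_up -!upD; congr (phi i (up _)); ring.
by rewrite -phiV // !invmx_up phi_cj // invmx_up -!upD; congr (phi i (up _)); ring.
Qed.

Lemma conj_lo i r : conj_set (phi i (lo r)) (U (- al i)) = U (- al i).
Proof.
apply: conj_set_eq => _ /U_NalP[t ->]; apply/U_NalP; exists t.
  by rewrite phi_cj // invmx_lo -!loD; congr (phi i (lo _)); ring.
by rewrite -phiV // !invmx_lo phi_cj // invmx_lo -!loD; congr (phi i (lo _)); ring.
Qed.

Lemma conj_setM x y S : conj_set (x * y) S = conj_set x (conj_set y S).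
Proof.
apply: conj_set_eq => z.
  by move=> Sz; rewrite cjA; exists (cj y z) => //; exists z.
by case=> _ [u Su <-] <-; rewrite invgM cjA -!/(cj _ _) !cjK.
Qed.

Lemma conj_set_cancel x S T : conj_set x S = conj_set x T -> S = T.
Proof.
have h Y : conj_set x^-1 (conj_set x Y) = Y.
  rewrite -conj_setM mulVg; apply: conj_set_eq => z; by rewrite ?invg1 cj1.
by move=> e; rewrite -(h S) e h.
Qed.

(* The element y x z of U_refl is some phi i g with g antidiagonal: a nonzero
   diagonal entry of g would make the root groups of al i and - al i equal. *)
Lemma phi_nn_conj i b : root b -> conj_set (phi i nn) (U b) = U (refl i b).
Proof.
have [x ux x1] : exists2 x, U (al i) x & x <> 1.
  apply: contrapT => h; apply: (@U_nontrivial _ _ _ _ _ X (al i)).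
    exact: root_al.
  apply/seteqP; split=> [x ux|_ ->].
    by apply: contrapT => x1; apply: h; exists x.
  by have [] := U_group (@root_al _ _ D i).
have [y [z [uy uz yxz]]] := U_refl ux x1.
have [g dg1 gE] : exists2 g : 'M[F]_2, \det g = 1%R & y * x * z = phi i g.
  move/U_alP: ux => [r ->]; move/U_NalP: uy => [s ->]; move/U_NalP: uz => [t ->].
  by exists (lo s *m up r *m lo t) => //; rewrite !phiM.
rewrite gE {y z x ux x1 uy uz gE} in yxz.
move: yxz dg1; rewrite (mx2P g) det_mx2.
move: (g 0%R 0%R) (g 0%R 1%R) (g 1%R 0%R) (g 1%R 1%R) => {g} p q s t yxz e.
have p0 : p = 0%R.
  apply: contrapT => /eqP p0; apply: (@U_al_neq i).
  have gE : mx2 p q s t = lo (s / p) *m dg p *m up (q / p).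
    rewrite !mx2M; have -> : t = ((1 + q * s) / p)%R by rewrite -e; field.
    by congr mx2; field.
  have := yxz _ (@root_al _ _ D i).
  rewrite gE !phiM // !conj_setM conj_up (phi_dg i p0) ?refl_froot; last exact: root_al.
  by rewrite -[in RHS](conj_lo i (s / p)%R) => /conj_set_cancel.
have t0 : t = 0%R.
  apply: contrapT => /eqP t0; apply: (@U_al_neq i).
  have ti0 : (t^-1 != 0)%R by rewrite invr_neq0.
  have gE : mx2 p q s t = up (q / t) *m dg t^-1 *m lo (s / t).
    rewrite !mx2M; have -> : p = ((1 + q * s) / t)%R by rewrite -e; field.
    by congr mx2; field.
  have := yxz _ (root_opp (@root_al _ _ D i)).
  rewrite gE !phiM // !conj_setM conj_lo (phi_dg i ti0) ?reflN ?refl_froot ?opprK;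
    last by apply: root_opp; exact: root_al.
  by rewrite -[in RHS](conj_up i (q / t)%R) => /conj_set_cancel.
have q0 : q != 0%R.
  by apply/eqP => q0; move/eqP: e; rewrite p0 q0 !mul0r subr0 eq_sym oner_eq0.
have gE : mx2 p q s t = dg q *m nn.
  rewrite mx2M p0 t0; have -> : s = (- q^-1)%R.
    by apply: (mulfI q0); rewrite mulrN divff // -e p0; ring.
  by congr mx2; ring.
move=> rb; apply: (@conj_set_cancel (phi i (dg q))).
rewrite -conj_setM -phiM // -gE yxz // (phi_dg i q0) //.
exact: root_refl.
Qed.

Lemma nU i b x : root b -> U b x -> U (refl i b) (cj (phi i nn) x).
Proof. by move=> rb; apply: (conj_setE (phi_nn_conj i rb)).1. Qed.

Lemma nVU i b x : root b -> U b x -> U (refl i b) (cj (phi i nn)^-1 x).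
Proof.
move=> rb ux; apply: (conj_setE (phi_nn_conj i (root_refl i rb))).2.
by rewrite reflK.
Qed.

Lemma lift_nil : lift [::] = 1.
Proof. by rewrite /weyl_lift big_nil. Qed.

Lemma lift_cons i w : lift (i :: w) = phi i nn * lift w.
Proof. by rewrite /weyl_lift big_cons. Qed.

Lemma liftU w b x : root b -> U b x -> U (weyl w b) (cj (lift w) x).
Proof.
move=> rb ux; elim: w => [|i w IH]; first by rewrite lift_nil cj1.
by rewrite lift_cons cjA; apply: nU => //; apply: root_weyl.
Qed.

Lemma liftVU w b x : root b -> U b x -> U (weyl (rev w) b) (cj (lift w)^-1 x).
Proof.
elim: w b x => [|i w IH] b x rb ux; first by rewrite lift_nil invg1 cj1.
rewrite lift_cons invgM cjA rev_cons weyl_rcons; apply: IH; first exact: root_refl.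
exact: nVU.
Qed.

Lemma lift_torus v w : weyl v =1 weyl w -> torus ((lift v)^-1 * lift w).
Proof.
move=> vw b rb; apply: conj_set_eq => x ux.
  by rewrite cjA -[b](weylK D v) vw; apply: liftVU; [exact: root_weyl|exact: liftU].
rewrite invgM invgK cjA -[b](weylK D w) -vw.
by apply: liftVU; [exact: root_weyl|exact: liftU].
Qed.

Lemma U_commute a b x y : root a -> root b -> a <> b -> prenilpotent D a b ->
  U a x -> U b y -> exists2 z, genU (open_interval D a b) z & cj x y = z * y.
Proof.
move=> ra rb ab pab ux uy; exists [~ x^-1, y^-1].
  apply: U_comm => //; first by have [_ _ h] := U_group ra; apply: h.
  by have [_ _ h] := U_group rb; apply: h.
by rewrite /commg /conjg /cj !invgK !mulgA mulgVK.
Qed.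

Definition other_pos i : set 'rV[int]_n := [set b | pos b /\ b <> al i].

Lemma other_pos_refl i b : other_pos i b -> other_pos i (refl i b).
Proof.
move=> [pb bi]; split; first exact: refl_pos.
move=> e; apply: (pos_neg pb); rewrite -(reflK D i b) e refl_froot.
by apply: neg_opp; exact: pos_al.
Qed.

Lemma other_pos_nn i x : genU (other_pos i) x -> genU (other_pos i) (cj (phi i nn) x).
Proof.
apply: genU_cj => b {}x pb ux; apply: (genU_in (b := refl i b)); first exact: other_pos_refl.
by apply: nU => //; case: pb => /pos_root.
Qed.

Lemma other_pos_nnV i x :
  genU (other_pos i) x -> genU (other_pos i) (cj (phi i nn)^-1 x).
Proof.
apply: genU_cj => b {}x pb ux; apply: (genU_in (b := refl i b)); first exact: other_pos_refl.
by apply: nVU => //; case: pb => /pos_root.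
Qed.

Lemma commute_up i b r x : other_pos i b -> prenilpotent D (al i) b -> U b x ->
  genU (other_pos i) (cj (phi i (up r)) x).
Proof.
move=> pb pre ux; have [pb1 bi] := pb.
have ib : al i <> b by move=> e; apply: bi.
have ui : U (al i) (phi i (up r)) by apply/U_alP; exists r.
have [z zI ->] := U_commute (@root_al _ _ D i) (pos_root pb1) ib pre ui ux.
apply: gen_mul; last exact: genU_in pb ux.
apply: genU_sub zI => c [rc ca _ h]; split=> //.
by apply: (h true [::]) => //; exact: pos_al.
Qed.

Lemma commute_lo i b r x : other_pos i b -> prenilpotent D (- al i) b -> U b x ->
  genU (other_pos i) (cj (phi i (lo r)) x).
Proof.
move=> pb pre ux; have [pb1 bi] := pb.
have ri : root (- al i) by apply: root_opp; exact: root_al.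
have ib : - al i <> b by move=> e; apply: (pos_neg pb1); rewrite -e; apply: neg_opp; exact: pos_al.
have ui : U (- al i) (phi i (lo r)) by apply/U_NalP; exists r.
have [z zI ->] := U_commute ri (pos_root pb1) ib pre ui ux.
apply: gen_mul; last exact: genU_in pb ux.
apply: genU_sub zI => c [rc ca _ h].
have := h true [:: i]; rewrite /= reflN refl_froot opprK.
move=> /(_ (pos_al D i) (proj1 (other_pos_refl pb))) pc.
rewrite -(reflK D i c); apply: other_pos_refl; split=> // e.
by apply: ca; rewrite -(reflK D i c) e refl_froot.
Qed.

(** Both roots of either pair can be made positive, by the empty word for [al i] and by [[:: i]] for
    [- al i]. A word u making b negative makes exactly one of [al i] and [- al i] negative at the
    same time. *)
Lemma prenilpotent_or i b : other_pos i b ->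
  prenilpotent D (al i) b \/ prenilpotent D (- al i) b.
Proof.
move=> pb; have [[rb _] bi] := pb; have [w [k bE]] := rb.
pose u := k :: rev w.
have ub : neg (weyl u b).
  by rewrite /= bE weylK refl_froot; apply: neg_opp; exact: pos_al.
have [ua|ua] := root_sign (root_weyl u (@root_al _ _ D i)).
  right=> -[]; last by exists u; split=> //; rewrite weylN; exact: neg_opp.
  exists [:: i]; rewrite /= reflN refl_froot opprK; split; first exact: pos_al.
  exact: (proj1 (other_pos_refl pb)).
left=> -[]; last by exists u.
by exists [::]; split; [exact: pos_al|case: pb].
Qed.

Lemma bruhat_upper g : \det g = 1%R -> exists r s t, t != 0%R /\
  (g = up r *m up s *m dg t \/ g = up r *m invmx nn *m up s *m dg t).
Proof.
move=> dg1; have [r [c [/lowerE[t [s [t0 ->]]] e]]] := bruhat (det1M dg1 (det_nn F)).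
have gE : g = g *m nn *m invmx nn by rewrite mulmxK ?det1_unit.
have cE : lo s *m (dg t *m invmx nn) = invmx nn *m (up (- s) *m dg t^-1).
  by rewrite invmx_nn !mx2M invrK; congr mx2; ring.
exists r; case: e => e; rewrite {}e in gE; exists (- s)%R, t^-1%R; rewrite invr_eq0;
  split=> //; [right|left].
  by rewrite gE -!mulmxA cE.
by rewrite gE -!mulmxA cE mulKVmx ?det1_unit.
Qed.

(** The decomposition of g is chosen so that its right-hand unipotent factor belongs to the root
    that is prenilpotent with b. That factor and [nn] keep x among the other positive root groups,
    and the factor on the left lies in $U_+$ itself. *)
Lemma phi_cj_Upos i b g x : other_pos i b -> \det g = 1%R -> U b x ->
  Upos (cj (phi i g) x).
Proof.
move=> pb dg1 ux; have sub : genU (other_pos i) `<=` Upos by apply: genU_sub => c [].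
have gU r y : Upos y -> Upos (cj (phi i (up r)) y).
  have ur : Upos (phi i (up r)) by apply: genU_in (pos_al D i) _; apply/U_alP; exists r.
  by move=> uy; apply: gen_mul; [apply: gen_mul|apply: gen_inv].
have dU t : t != 0%R -> U b (cj (phi i (dg t)) x).
  by move=> t0; apply: torus_U ux; [exact: phi_dg|case: pb => /pos_root].
case: (prenilpotent_or pb) => pre.
  have [r [s [t [t0 [->|->]]]]] := bruhat_upper dg1; rewrite !phiM // !cjA; apply: (gU).
    by apply: gU; apply: (genU_in (b := b)); [case: pb|exact: dU].
  by apply: sub; rewrite phiV //; apply: other_pos_nnV; apply: commute_up (dU t t0).
have [r [c [/lowerE[t [s [t0 ->]]] [->|->]]]] := bruhat dg1; rewrite !phiM // !cjA; apply: (gU).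
  by apply: sub; apply: commute_lo (dU t t0).
by apply: sub; apply: other_pos_nn; apply: commute_lo (dU t t0).
Qed.

(* The unipotent radical of the minimal parabolic subgroup attached to i. *)
Definition radical i : set G := generated
  [set y | exists g b x, [/\ \det g = 1%R, other_pos i b, U b x & y = cj (phi i g) x]].

Lemma radical_group i : is_subgroup (radical i).
Proof. exact: gen_group. Qed.

Lemma radical_Upos i : radical i `<=` Upos.
Proof.
apply: gen_min; first exact: genU_group.
by move=> _ [g [b [x [dg1 pb ux ->]]]]; apply: phi_cj_Upos ux.
Qed.

Lemma radical_cj i g x : \det g = 1%R -> radical i x -> radical i (cj (phi i g) x).
Proof.
move=> dg1; apply: gen_cj => _ [h [b [y [dh pb uy ->]]]].
by apply: gen_in; exists (g *m h), b, y; split=> //; rewrite phiM // cjA.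
Qed.

Lemma radical_cjV i g x : \det g = 1%R -> radical i x -> radical i (cj (phi i g)^-1 x).
Proof. by move=> dg1; rewrite -phiV //; apply: radical_cj. Qed.

Lemma radical_genU i : genU (other_pos i) `<=` radical i.
Proof.
apply: genU_min => [|b x pb ux]; first exact: radical_group.
by apply: gen_in; exists 1%:M, b, x; rewrite det1 phi1 cj1.
Qed.

(** Conjugation by [nn] preserves the radical and turns this element into one of the opposite root
    group, which meets $U_+$ trivially. *)
Lemma radical_up i r : radical i (phi i (up r)) -> r = 0%R.
Proof.
move=> /(radical_cj (det_nn F)); rewrite phi_cj // nn_up => /radical_Upos/phi_lo_Upos/eqP.
by rewrite oppr_eq0 => /eqP.
Qed.

Lemma phi_up_Upos i r : Upos (phi i (up r)).
Proof. by apply: genU_in (pos_al D i) _; apply/U_alP; exists r. Qed.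

Lemma phi_upD i r s : phi i (up (r + s)) = phi i (up r) * phi i (up s).
Proof. by rewrite upD phiM. Qed.

Lemma phi_upN i r : phi i (up (- r)) = (phi i (up r))^-1.
Proof. by rewrite -invmx_up phiV. Qed.

(** With [radical_up_inj] this is the semidirect decomposition of $U_+$ into the radical and
    $U_{\alpha_i}$, the source of the coordinates in [chart]. *)
Lemma Upos_radical i x : Upos x ->
  exists y r, radical i y /\ x = y * phi i (up r).
Proof.
have [R1 RM RV] := radical_group i.
move: x; apply: genU_min; first split.
- by exists 1, 0%R; rewrite up0 phi1 mulg1.
- move=> _ _ [y [r [ry ->]]] [z [s [rz ->]]].
  exists (y * cj (phi i (up r)) z), (r + s)%R; split.
    by apply: RM => //; exact: radical_cj.
  by rewrite phi_upD /cj !mulgA mulgVK.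
- move=> _ [y [r [ry ->]]]; exists (cj (phi i (up (- r))) y^-1), (- r)%R; split.
    by apply: radical_cj => //; exact: RV.
  by rewrite invgM -phi_upN /cj mulgVK.
move=> b x pb ux; have [bi|bi] := pselect (b = al i).
  by move: ux; rewrite bi => /U_alP[r ->]; exists 1, r; rewrite mul1g.
exists x, 0%R; rewrite up0 phi1 mulg1; split=> //; apply: radical_genU.
exact: (genU_in (b := b)).
Qed.

Lemma radical_up_inj i y z r s : radical i y -> radical i z ->
  y * phi i (up r) = z * phi i (up s) -> y = z /\ r = s.
Proof.
move=> ry rz e; have [R1 RM RV] := radical_group i.
have : z^-1 * y = phi i (up (s - r)).
  by apply: (mulIg (phi i (up r))); rewrite -mulgA e mulKg phi_upD phi_upN mulgVK.
move=> h; have : radical i (phi i (up (s - r))) by rewrite -h; apply: RM => //; exact: RV.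
move=> /radical_up sr; split; last by apply/esym/eqP; rewrite -subr_eq0 sr.
by apply: (mulgI z^-1); rewrite mulVg h sr up0 phi1.
Qed.

(* The subgroup of U_+ that fixes the chamber w B_- of the negative building. *)
Definition chamber_fix w : set G := genU (inversions D w).

(** Equivalently, the length of $s_iw$ exceeds that of $w$; of the chambers $wB_-$ and $s_iwB_-$,
    the first is then the one fixed by $U_{-\alpha_i}$. *)
Definition low_cell i w := pos (weyl (rev w) (al i)).

Lemma chamber_fix_group w : is_subgroup (chamber_fix w).
Proof. exact: gen_group. Qed.

Lemma low_inversions i w : low_cell i w -> inversions D w `<=` other_pos i.
Proof. by move=> lw b [pb nb]; split=> // e; apply: (pos_neg lw); rewrite -e. Qed.

Lemma chamber_fix_radical i w : low_cell i w -> chamber_fix w `<=` radical i.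
Proof.
move=> lw; apply: subset_trans (@radical_genU i).
by apply: genU_sub; exact: low_inversions.
Qed.

Lemma inversions_ext v w : weyl v =1 weyl w -> inversions D v = inversions D w.
Proof. by move=> /weyl_rev_ext vw; apply/seteqP; split=> b [pb nb]; split; rewrite ?vw // -vw. Qed.

Lemma chamber_fix_id w x : weyl w =1 id -> chamber_fix w x -> x = 1.
Proof.
move=> w1; apply: (@genU_min _ [set 1]).
  by split=> // [y z -> ->|y ->]; rewrite ?mulg1 ?invg1.
move=> b y [pb nb]; case: (pos_neg pb).
by have := @weyl_rev_ext _ _ D w [::] w1 b; rewrite /= => <-.
Qed.

(** For an inversion b of w, the reflection in i makes [- al i] and b both positive and the inverse
    of w makes both negative. So the pair is prenilpotent, and every root strictly between them is
    again an inversion of w. *)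
Lemma chamber_fix_lower i w g x : low_cell i w -> lower g -> chamber_fix w x ->
  chamber_fix w (cj (phi i g) x).
Proof.
move=> lw /lowerE[t [r [t0 ->]]] fx; rewrite phiM // cjA.
have {fx} : chamber_fix w (cj (phi i (dg t)) x).
  by apply: torus_genU fx; [exact: phi_dg|move=> b [/pos_root]].
apply: genU_cj => {x} b x wb ux; have [pb nb] := wb.
have ob := low_inversions lw wb.
have ri : root (- al i) by apply: root_opp; exact: root_al.
have ib : - al i <> b by move=> e; apply: (pos_neg pb); rewrite -e; apply: neg_opp; exact: pos_al.
have ui : U (- al i) (phi i (lo r)) by apply/U_NalP; exists r.
have p1 : pos (weyl [:: i] (- al i)) by rewrite /= reflN refl_froot opprK; exact: pos_al.
have p2 : pos (weyl [:: i] b) by case: (other_pos_refl ob).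
have n1 : neg (weyl (rev w) (- al i)) by rewrite weylN; exact: neg_opp.
have pre : prenilpotent D (- al i) b by case; [exists [:: i]|exists (rev w)].
have [z zI ->] := U_commute ri (pos_root pb) ib pre ui ux.
apply: gen_mul; last exact: genU_in wb ux.
apply: genU_sub zI => c [rc ca _ h]; split; last exact: (h false).
have oc : other_pos i (refl i c).
  split; first exact: (h true [:: i]).
  by move=> e; apply: ca; rewrite -(reflK D i c) e refl_froot.
by rewrite -(reflK D i c); case: (other_pos_refl oc).
Qed.

Lemma inversions_cons i w b : low_cell i w ->
  inversions D (i :: w) b <-> b = al i \/ inversions D w (refl i b).
Proof.
move=> lw; rewrite /inversions /= rev_cons weyl_rcons; split=> [[pb nb]|[->|[pb nb]]].
- have [->|bi] := pselect (b = al i); [by left|right; split=> //].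
  exact: refl_pos.
- by split; [exact: pos_al|rewrite refl_froot weylN; apply: neg_opp].
- split=> //; have ob : other_pos i (refl i b) by apply: low_inversions lw _ _.
  by rewrite -(reflK D i b); case: (other_pos_refl ob).
Qed.

(** In other words $U_{(s_iw)}$ is the semidirect product of $nU_{(w)}n^{-1}$ and $U_{\alpha_i}$.
    Conjugating by [up s] on the inside of $n^{-1}$ becomes conjugating by a lower matrix on the
    outside, which preserves $U_{(w)}$. *)
Lemma chamber_fix_cons i w y r : low_cell i w -> radical i y ->
  chamber_fix (i :: w) (y * phi i (up r)) <-> chamber_fix w (cj (phi i nn)^-1 y).
Proof.
move=> lw ry; have [V1 VM VV] := chamber_fix_group w; split.
  have gS : is_subgroup [set z | exists y r, [/\ radical i y, z = y * phi i (up r) &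
      chamber_fix w (cj (phi i nn)^-1 y)]].
    have [R1 RM RV] := radical_group i.
    have nup s : (phi i nn)^-1 * phi i (up s) = phi i (lo (- s)) * (phi i nn)^-1.
      rewrite -phiV // -!phiM //; congr (phi i _).
      by rewrite invmx_nn !mx2M; congr mx2; ring.
    have key s z : chamber_fix w (cj (phi i nn)^-1 z) ->
        chamber_fix w (cj (phi i nn)^-1 (cj (phi i (up s)) z)).
      rewrite -cjA nup cjA => fz; apply: chamber_fix_lower => //.
      exact: lower_lo.
    split.
    - by exists 1, 0%R; rewrite up0 phi1 mulg1 cjg1.
    - move=> _ _ [z [s [rz -> fz]]] [z' [s' [rz' -> fz']]].
      exists (z * cj (phi i (up s)) z'), (s + s')%R; split.
      + by apply: RM => //; exact: radical_cj.
      + by rewrite phi_upD /cj !mulgA mulgVK.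
      + by rewrite cjM; apply: VM => //; exact: key.
    - move=> _ [z [s [rz -> fz]]]; exists (cj (phi i (up (- s))) z^-1), (- s)%R; split.
      + by apply: radical_cj => //; exact: RV.
      + by rewrite invgM -phi_upN /cj mulgVK.
      + by apply: key; rewrite cjV; exact: VV.
  have sub : chamber_fix (i :: w) `<=` [set z | exists y r,
      [/\ radical i y, z = y * phi i (up r) & chamber_fix w (cj (phi i nn)^-1 y)]].
    apply: genU_min => // b z /(inversions_cons _ lw)[->|wb] uz.
      move/U_alP: uz => [s ->]; exists 1, s; rewrite mul1g cjg1; split=> //.
      by have [] := radical_group i.
    have ob := low_inversions lw wb.
    have rb : root b by rewrite -(reflK D i b); apply: root_refl; case: ob => /pos_root.
    exists z, 0%R; rewrite up0 phi1 mulg1; split=> //.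
      apply: radical_genU; apply: (genU_in (b := b)) => //.
      by rewrite -(reflK D i b); exact: other_pos_refl.
    by apply: (genU_in (b := refl i b)) => //; exact: nVU.
  by move=> /sub[y' [r' [ry' /(radical_up_inj ry ry')[-> _]]]].
move=> fy; apply: gen_mul; last first.
  apply: (genU_in (b := al i)); first by apply/inversions_cons => //; left.
  by apply/U_alP; exists r.
rewrite -(cjVK (phi i nn) y); apply: genU_cj fy => b z wb uz.
apply: (genU_in (b := refl i b)); first by apply/inversions_cons => //; right; rewrite reflK.
by apply: nU => //; case: wb => /pos_root.
Qed.

(** Here $s_iw=ws_j$, so $s_i$ permutes the inversions of w and [nn] normalizes $U_{(w)}$; together
    with the lower triangular matrices it generates all of $\mathrm{SL}_2$. *)
Lemma chamber_fix_special i j w g x : weyl w (al j) = al i -> \det g = 1%R ->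
  chamber_fix w x -> chamber_fix w (cj (phi i g) x).
Proof.
move=> wji dg1; have lw : low_cell i w by rewrite /low_cell -wji weylK; exact: pos_al.
have wi : weyl (rev w) (al i) = al j by rewrite -wji weylK.
have inv_refl b : inversions D w b -> inversions D w (refl i b).
  move=> wb; have ob := low_inversions lw wb.
  split; first by case: (other_pos_refl ob).
  rewrite (refl_weyl_rev _ wji).
  apply: refl_neg; first by case: wb.
  rewrite -wi -weylN => /weyl_inj e; case: wb => pb _; apply: (pos_neg pb).
  by rewrite e; apply: neg_opp; exact: pos_al.
have fn y : chamber_fix w y -> chamber_fix w (cj (phi i nn) y).
  apply: genU_cj => b z wb uz; apply: (genU_in (b := refl i b)); first exact: inv_refl.
  by apply: nU => //; case: wb => /pos_root.
have fnV y : chamber_fix w y -> chamber_fix w (cj (phi i nn)^-1 y).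
  apply: genU_cj => b z wb uz; apply: (genU_in (b := refl i b)); first exact: inv_refl.
  by apply: nVU => //; case: wb => /pos_root.
have fup r y : chamber_fix w y -> chamber_fix w (cj (phi i (up r)) y).
  move=> fy; have -> : up r = nn *m lo (- r) *m invmx nn by rewrite nn_lo opprK.
  rewrite !phiM // phiV // !cjA; apply: fn; apply: chamber_fix_lower; [by []|exact: lower_lo|].
  exact: fnV.
have [r [c [lc [->|->]]]] := bruhat dg1; rewrite !phiM // !cjA => fx; apply: fup.
  exact: chamber_fix_lower.
by apply: fn; apply: chamber_fix_lower.
Qed.

(** * The covering of the negative building *)

Local Notation point := (G * seq 'I_n)%type.
Implicit Types (p q : point) (e : option 'I_n).

Definition weq v w := weyl v =1 weyl w.

Lemma weq_refl w : weq w w. Proof. by []. Qed.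
Lemma weq_sym v w : weq v w -> weq w v. Proof. by move=> e a; rewrite e. Qed.
Lemma weq_trans u v w : weq u v -> weq v w -> weq u w.
Proof. by move=> e e' a; rewrite e e'. Qed.
Lemma weq_cons i v w : weq v w -> weq (i :: v) (i :: w).
Proof. by move=> e a; rewrite /= e. Qed.
Lemma weq_cons2 i w : weq (i :: i :: w) w.
Proof. by move=> a; rewrite /= reflK. Qed.
Lemma weq_consI i v w : weq (i :: v) (i :: w) -> weq v w.
Proof. by move=> /(weq_cons i) h a; have := h a; rewrite /= !reflK. Qed.

Definition extw e w := if e is Some j then rcons w j else w.

Lemma weq_extw e v w : weq v w -> weq (extw e v) (extw e w).
Proof. by case: e => //= j vw a; rewrite !weyl_rcons vw. Qed.

Lemma extw_cons e i w : extw e (i :: w) = i :: extw e w.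
Proof. by case: e. Qed.

Lemma low_weq i v w : weq v w -> low_cell i v -> low_cell i w.
Proof. by rewrite /low_cell => /weyl_rev_ext ->. Qed.

Lemma low_cons i w : low_cell i (i :: w) <-> neg (weyl (rev w) (al i)).
Proof.
rewrite /low_cell rev_cons weyl_rcons refl_froot weylN; split=> h.
  by rewrite -[weyl _ _]opprK; apply: neg_opp.
exact: pos_opp.
Qed.

Lemma low_consF i w : low_cell i w -> low_cell i (i :: w) -> False.
Proof. by move=> lw /low_cons; apply: pos_neg. Qed.

Lemma low_or i w : low_cell i w \/ low_cell i (i :: w).
Proof.
have [h|h] := root_sign (root_weyl (rev w) (@root_al _ _ D i)); [by left|right].
exact/low_cons.
Qed.

(* A point (u, w) stands for the translate by u of the chamber w B_- ; working
   modulo chamber_fix w instead of the full stabilizer in U_+ makes the set of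
   points an a priori nontrivial covering of the negative building. near (Some j)
   relates points of a common j-panel and near None identifies equal points. *)
Definition near e p q :=
  (weq q.2 p.2 \/ weq q.2 (extw e p.2)) /\
  exists v, [/\ weq v p.2 \/ weq v (extw e p.2),
    forall j, e = Some j -> neg (weyl v (al j)) & chamber_fix v (p.1^-1 * q.1)].

(* Coordinates y, g on the points of the two cells w and i :: w: here (y, g) is
   an element of the semidirect product of radical i by SL_2, taken modulo
   chamber_fix w and the lower triangular matrices. *)
Definition chart i w y g p :=
  [/\ radical i y, low_cell i w, \det g = 1%R &
  exists r h, [/\ p.1 = y * phi i (up r), lower h &
    (g = up r *m h /\ weq p.2 w) \/ (g = up r *m nn *m h /\ weq p.2 (i :: w))]].

(** Left multiplication by [phi i h], which sends the product of y and g to the product of its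
    conjugate $hyh^{-1}$ and $hg$. It is a relation since representatives are not unique;
    [step_near] for [None] shows that it respects equality of points. *)
Definition step i h p q := \det h = 1%R /\
  exists w y g, chart i w y g p /\ chart i w (cj (phi i h) y) (h *m g) q.

Lemma chart_Upos i w y g p : chart i w y g p -> Upos p.1.
Proof.
move=> [ry _ _ [r [h [-> _ _]]]]; apply: gen_mul; first exact: radical_Upos ry.
exact: phi_up_Upos.
Qed.

Lemma chart_exists i p : Upos p.1 -> exists w y g, chart i w y g p.
Proof.
case: p => u w /= /(Upos_radical i)[y [r [ry ->]]].
case: (low_or i w) => lw.
  exists w, y, (up r); split=> //; exists r, 1%:M; split=> //; first exact: lower1.
  by left; rewrite mulmx1.
exists (i :: w), y, (up r *m nn); split=> //; exists r, 1%:M; split=> //; first exact: lower1.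
by right; rewrite mulmx1; split=> //; apply: weq_sym; exact: weq_cons2.
Qed.

Lemma chart_point i w y g : radical i y -> low_cell i w -> \det g = 1%R ->
  exists p, chart i w y g p.
Proof.
move=> ry lw dg1; have [r [h [lh [gE|gE]]]] := bruhat dg1.
  by exists (y * phi i (up r), w); split=> //; exists r, h; split=> //; left.
by exists (y * phi i (up r), i :: w); split=> //; exists r, h; split=> //; right.
Qed.

Lemma step_total i h p : \det h = 1%R -> Upos p.1 -> exists q, step i h p q.
Proof.
move=> dh /(chart_exists i)[w [y [g cp]]]; have [ry lw dg1 _] := cp.
have [q cq] := chart_point (radical_cj dh ry) lw (det1M dh dg1).
by exists q; split=> //; exists w, y, g.
Qed.

Lemma step_inv i h p q : step i h p q -> step i (invmx h) q p.
Proof.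
move=> [dh [w [y [g [cp cq]]]]]; split; first exact: det1V.
exists w, (cj (phi i h) y), (h *m g); split=> //.
by rewrite phiV // cjK mulKmx // det1_unit.
Qed.

(** The condition that $(yg)^{-1}y'g'$ lie in the product of [chamber_fix v] and the lower
    triangular group; in this form it is invariant under left translation. *)
Definition same_flag i g g' y y' v :=
  lower (invmx g *m g') /\ chamber_fix v (cj (phi i g)^-1 (y^-1 * y')).

Lemma same_flag_move i h g g' y y' v : \det h = 1%R -> \det g = 1%R -> \det g' = 1%R ->
  same_flag i (h *m g) (h *m g') (cj (phi i h) y) (cj (phi i h) y') v <->
  same_flag i g g' y y' v.
Proof.
move=> dh dg1 dg'; rewrite /same_flag invmx_det1M // -!mulmxA mulKmx ?det1_unit //.
by rewrite phiM // -cjV -cjM invgM cjA cjK.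
Qed.

Lemma point_diff i y y' r r' :
  (y * phi i (up r))^-1 * (y' * phi i (up r')) =
  cj (phi i (up r))^-1 (y^-1 * y') * phi i (up (r' - r)).
Proof. by rewrite addrC phi_upD phi_upN /cj invgK invgM !mulgA mulgK. Qed.

Lemma radical_diff i y y' : radical i y -> radical i y' -> radical i (y^-1 * y').
Proof. by move=> ry ry'; apply: gen_mul => //; apply: gen_inv. Qed.

Lemma up_diag r : up (r - r) = 1%:M.
Proof. by rewrite subrr; exact: up0. Qed.

(** Both sides force r = r': on the left because $U_{(w)}$ lies in the radical, on the right because
    an upper unipotent matrix that is lower triangular is trivial. *)
Lemma same_flag_low i w y y' r r' h h' : low_cell i w -> radical i y -> radical i y' ->
  lower h -> lower h' ->
  chamber_fix w ((y * phi i (up r))^-1 * (y' * phi i (up r'))) <->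
  same_flag i (up r *m h) (up r' *m h') y y' w.
Proof.
move=> lw ry ry' lh lh'; have dh := proj1 lh; have dh' := proj1 lh'.
rewrite point_diff /same_flag phiM // invgM cjA.
set z := cj (phi i (up r))^-1 _.
have rz : radical i z by apply: radical_cjV => //; exact: radical_diff.
have -> : invmx (up r *m h) *m (up r' *m h') = invmx h *m up (r' - r) *m h'.
  by rewrite invmx_det1M // invmx_up addrC upD -!mulmxA.
have lE : lower (invmx h *m up (r' - r) *m h') <-> r' = r.
  split=> [l|->]; last by rewrite up_diag mulmx1; apply: lowerM => //; exact: lowerV.
  apply/eqP; rewrite -subr_eq0; apply/eqP; apply: up_lower; have := lowerM lh (lowerM l (lowerV lh')).
  by rewrite mulmxK ?det1_unit // mulKVmx ?det1_unit.
have zE : chamber_fix w (cj (phi i h)^-1 z) <-> chamber_fix w z.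
  split=> fz; last by rewrite -phiV //; apply: chamber_fix_lower => //; exact: lowerV.
  by rewrite -(cjVK (phi i h) z); apply: chamber_fix_lower.
rewrite lE zE; split=> [fz|[-> fz]]; last by rewrite up_diag phi1 mulg1.
have rfz := chamber_fix_radical lw fz.
have e : r' = r.
  apply: subr0_eq; apply: (@radical_up i).
  by rewrite -(mulKg z (phi i _)); apply: gen_mul => //; apply: gen_inv.
by move: fz; rewrite e up_diag phi1 mulg1.
Qed.

(** In this cell r is irrelevant on both sides: $U_{(s_iw)}$ contains $U_{\alpha_i}$, and [nn]
    conjugates the upper unipotent difference into a lower one. *)
Lemma same_flag_high i w y y' r r' h h' : low_cell i w -> radical i y -> radical i y' ->
  lower h -> lower h' ->
  chamber_fix (i :: w) ((y * phi i (up r))^-1 * (y' * phi i (up r'))) <->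
  same_flag i (up r *m nn *m h) (up r' *m nn *m h') y y' w.
Proof.
move=> lw ry ry' lh lh'; have dh := proj1 lh; have dh' := proj1 lh'.
rewrite point_diff /same_flag !phiM // !invgM !cjA.
set z := cj (phi i (up r))^-1 _.
have rz : radical i z by apply: radical_cjV => //; exact: radical_diff.
rewrite chamber_fix_cons //; set z' := cj (phi i nn)^-1 z.
have zE : chamber_fix w (cj (phi i h)^-1 z') <-> chamber_fix w z'.
  split=> fz; last by rewrite -phiV //; apply: chamber_fix_lower => //; exact: lowerV.
  by rewrite -(cjVK (phi i h) z'); apply: chamber_fix_lower.
rewrite zE; split=> [fz|[]//]; split=> //.
have -> : invmx (up r *m nn *m h) *m (up r' *m nn *m h') = invmx h *m lo (r - r') *m h'.
  rewrite !invmx_det1M // -?mulmxA; congr (_ *m _).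
  by rewrite !mulmxA invmx_up -(mulmxA (invmx nn)) -upD invmx_nn !mx2M; congr (_ *m _); congr mx2; ring.
by apply: lowerM => //; apply: lowerM; [exact: lowerV|exact: lower_lo].
Qed.

Lemma lower_mixed (r r' : F) (h h' : 'M[F]_2) : lower h -> lower h' ->
  ~ lower (invmx (up r *m h) *m (up r' *m nn *m h')).
Proof.
move=> lh lh' l; have dh := proj1 lh; have dh' := proj1 lh'.
apply: (@lower_nn _ (r' - r)).
have := lowerM lh (lowerM l (lowerV lh')).
by rewrite invmx_det1M // !mulmxA mulmxK ?det1_unit // mulmxV ?det1_unit // mul1mx
  invmx_up -upD addrC.
Qed.

Lemma lower_mixed' (r r' : F) (h h' : 'M[F]_2) : lower h -> lower h' ->
  ~ lower (invmx (up r' *m nn *m h') *m (up r *m h)).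
Proof.
move=> lh lh' /lowerV; have dh := proj1 lh; have dh' := proj1 lh'.
by rewrite (@invmx_det1M _ (invmx _)) // invmxK; exact: lower_mixed.
Qed.

Lemma weq_low_cons i v w : weq v (i :: w) -> low_cell i w -> low_cell i v -> False.
Proof. by move=> vw lw /(low_weq vw); exact: low_consF. Qed.

Definition wnear e v w := weq v w \/ weq v (extw e w).

Lemma wnear_weq e v w v' w' : weq v' v -> weq w' w -> wnear e v w -> wnear e v' w'.
Proof.
move=> vv ww [vw|vw]; [left|right]; apply: weq_trans vv (weq_trans vw _).
  exact: weq_sym.
by apply: weq_extw; exact: weq_sym.
Qed.

Lemma wnear_cons e i v w : wnear e v w -> wnear e (i :: v) (i :: w).
Proof. by rewrite /wnear extw_cons => -[h|h]; [left|right]; exact: weq_cons. Qed.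

(** When [low_cell i w] holds the value [- al i] is excluded too, so the wall of the i-th root does
    not separate w from its j-neighbour. *)
Definition generic e i w := forall j, e = Some j -> weyl w (al j) <> al i.

Lemma generic_neq e i w v j : low_cell i w -> generic e i w -> wnear e v w -> e = Some j ->
  weyl v (al j) <> al i /\ weyl v (al j) <> - al i.
Proof.
move=> lw gw wv ej.
have wN : weyl w (al j) <> - al i.
  move=> h; move: lw; rewrite /low_cell -[al i]opprK -h weylN weylK => pj.
  by apply: (pos_neg pj); apply: neg_opp; exact: pos_al.
case: wv => vw; first by rewrite vw; split=> //; exact: gw.
rewrite vw ej /= weyl_rcons refl_froot weylN; split=> h.
  by apply: wN; rewrite -h opprK.
by apply: (gw j) => //; apply: oppr_inj.
Qed.

Lemma generic_low e i v w : low_cell i w -> generic e i w -> wnear e v w -> low_cell i v.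
Proof.
move=> lw gw [vw|vw]; apply: (low_weq (weq_sym vw)) => //.
case: e gw vw => //= j gw vw.
rewrite /low_cell rev_rcons /=; apply: refl_pos => // h.
by apply: (gw j) => //; rewrite -h weylVK.
Qed.

Definition near_chart e i w y g w' y' g' := wnear e w' w /\
  exists v, [/\ wnear e v w, forall j, e = Some j -> neg (weyl v (al j)) &
    same_flag i g g' y y' v].

(** Adjacent points lie in the same cell of the chart, where [same_flag_low] or [same_flag_high]
    translates the condition. Points of different cells are excluded on both sides. *)
Lemma near_generic e i w y g p w' y' g' p' : generic e i w ->
  chart i w y g p -> chart i w' y' g' p' ->
  near e p p' <-> near_chart e i w y g w' y' g'.
Proof.
case: p => u x; case: p' => u' x'; rewrite /near /near_chart /chart /=.
move=> gw [ry lw dg1 [r [h [-> lh gE]]]] [ry' lw' dg' [r' [h' [-> lh' gE']]]].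
have lowN v : wnear e v w -> low_cell i v by exact: generic_low.
(* Prefixing i preserves which chamber of the panel is the longer one, because $v\alpha_j$ is
   neither $\alpha_i$ nor $-\alpha_i$. *)
have key v : wnear e v w ->
    (forall j, e = Some j -> neg (weyl (i :: v) (al j))) <->
    (forall j, e = Some j -> neg (weyl v (al j))).
  move=> wv; split=> h0 j ej; have := h0 j ej; have [n1 n2] := generic_neq lw gw wv ej.
    rewrite /= => h1; rewrite -(reflK D i (weyl v _)); apply: refl_neg => // h2.
    by apply: n1; rewrite -(reflK D i (weyl v _)) h2 reflN refl_froot opprK.
  by move=> h1; apply: refl_neg.
case: gE gE' => -[-> xw] [] [-> xw'].
- split=> [[xx [v [vx vj fv]]]|[ww [v [vw vj sf]]]].
  + have vw : wnear e v w by apply: wnear_weq (weq_refl v) (weq_sym xw) vx.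
    split; first exact: wnear_weq (weq_sym xw') (weq_sym xw) xx.
    by exists v; split=> //; apply/same_flag_low => //; exact: lowN.
  + split; first exact: wnear_weq xw' xw ww.
    exists v; split=> //; first exact: wnear_weq (weq_refl v) xw vw.
    by apply/(@same_flag_low i v y y' r r' h h') => //; exact: lowN.
- split=> [[xx _]|[_ [v [_ _ [l _]]]]]; last by case: (lower_mixed lh lh' l).
  have : wnear e (i :: w') w by apply: wnear_weq (weq_sym xw') (weq_sym xw) xx.
  by move=> /lowN /(low_consF lw').
- split=> [[xx _]|[_ [v [_ _ [l _]]]]]; last by case: (lower_mixed' lh' lh l).
  have /(wnear_cons i) : wnear e w' (i :: w) by apply: wnear_weq (weq_sym xw') (weq_sym xw) xx.
  move=> /(wnear_weq (weq_refl _) (weq_sym (weq_cons2 i w))) /lowN.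
  by move=> /(low_consF lw').
- split=> [[xx [v [vx vj fv]]]|[ww [v [vw vj sf]]]].
  + have vv := weq_cons2 i v.
    have vw : wnear e (i :: v) w.
      have : wnear e v (i :: w) by apply: wnear_weq (weq_refl v) (weq_sym xw) vx.
      by move=> /(wnear_cons i) /(wnear_weq (weq_refl _) (weq_sym (weq_cons2 i w))).
    split.
      have : wnear e (i :: w') (i :: w) by apply: wnear_weq (weq_sym xw') (weq_sym xw) xx.
      move=> /(wnear_cons i).
      exact: (wnear_weq (weq_sym (weq_cons2 i w')) (weq_sym (weq_cons2 i w))).
    exists (i :: v); split=> //.
      by apply/(key (i :: v) vw) => // j ej; rewrite vv; exact: vj.
    apply/(@same_flag_high i (i :: v) y y' r r' h h') => //; first exact: lowN.
    by rewrite /chamber_fix (inversions_ext vv).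
  + split; first by apply: wnear_weq xw' xw _; exact: wnear_cons.
    exists (i :: v); split.
    * by apply: wnear_weq (weq_refl _) xw _; exact: wnear_cons.
    * by apply/(key v vw).
    * by apply/(@same_flag_high i v y y' r r' h h') => //; exact: lowN.
Qed.

(** The j-panel of w is now its i-panel, swept out by the i-th $\mathrm{SL}_2$ itself, so the
    matrices g and g' impose no condition. *)
Lemma near_special j i w y g p w' y' g' p' : weyl w (al j) = al i ->
  chart i w y g p -> chart i w' y' g' p' ->
  near (Some j) p p' <-> weq w' w /\ chamber_fix w (y^-1 * y').
Proof.
case: p => u x; case: p' => u' x'; rewrite /near /chart /=.
move=> wji [ry lw dg1 [r [h [-> lh gE]]]] [ry' lw' dg' [r' [h' [-> lh' gE']]]].
have wj : weq (rcons w j) (i :: w).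
  by move=> a; rewrite weyl_rcons (weyl_refl _ wji).
have xw : weq x w \/ weq x (i :: w) by case: gE => -[_]; [left|right].
have xw' : weq x' w' \/ weq x' (i :: w') by case: gE' => -[_]; [left|right].
have wjj : weq (rcons (i :: w) j) w.
  by move=> a; rewrite weyl_rcons /= (weyl_refl _ wji) reflK.
have xE v : (weq v x \/ weq v (rcons x j)) <-> (weq v w \/ weq v (i :: w)).
  case: xw => xw; have xwj := @weq_extw (Some j) _ _ xw; rewrite /= in xwj.
    have xi := weq_trans xwj wj.
    by split=> -[e|e]; [left|right|left|right]; apply: weq_trans e _ => //; apply: weq_sym.
  have xi := weq_trans xwj wjj.
  by split=> -[e|e]; [right|left|right|left]; apply: weq_trans e _ => //; apply: weq_sym.
rewrite xE.
have rd : radical i (cj (phi i (up r))^-1 (y^-1 * y')).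
  by apply: radical_cjV => //; exact: radical_diff.
have fE : chamber_fix (i :: w) ((y * phi i (up r))^-1 * (y' * phi i (up r'))) <->
    chamber_fix w (y^-1 * y').
  rewrite point_diff chamber_fix_cons // -!phiV // -cjA -phiM //.
  split=> fy; last by apply: chamber_fix_special wji _ fy.
  rewrite -(cjK (phi i (invmx nn *m invmx (up r))) (y^-1 * y')) -phiV //.
  by apply: chamber_fix_special wji _ fy.
have neg_wi : neg (weyl (i :: w) (al j)).
  by rewrite /= wji refl_froot; apply: neg_opp; exact: pos_al.
split=> [[xx [v [/xE vx vj fv]]]|[ww fy]].
  have vE : weq v (i :: w).
    case: vx => // vw; case: (pos_neg (pos_al D i)).
    by rewrite -wji -vw; exact: vj.
  split; last by apply/fE; rewrite /chamber_fix -(inversions_ext vE).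
  case: xw' xx => xw' [] /(weq_trans (weq_sym xw')) // e.
  - by case: (weq_low_cons e lw lw').
  - by case: (weq_low_cons (weq_sym e) lw' lw).
  - exact: weq_consI e.
split.
  case: xw' => /weq_trans xw'; [left|right]; apply: xw' => //.
  exact: weq_cons.
exists (i :: w); split; last by apply/fE.
  by apply/xE; right.
by move=> _ [<-].
Qed.

(** The condition in coordinates is invariant under translation by h: in the generic case by
    [same_flag_move], in the special case because all of $\mathrm{SL}_2$ normalizes $U_{(w)}$. *)
Lemma step_near e i h p q p' q' : step i h p q -> step i h p' q' ->
  near e p p' -> near e q q'.
Proof.
move=> [dh [w [y [g [cp cq]]]]] [_ [w' [y' [g' [cp' cq']]]]].
have [[j [ej wji]]|gw] := pselect (exists j, e = Some j /\ weyl w (al j) = al i).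
  rewrite ej => /(near_special wji cp cp')[ww fy].
  apply/(near_special wji cq cq'); split=> //.
  by rewrite -cjV -cjM; apply: chamber_fix_special wji _ fy.
have {}gw : generic e i w by move=> j ej wji; apply: gw; exists j.
move=> /(near_generic gw cp cp')[ww [v [vw vj sf]]].
apply/(near_generic gw cq cq'); split=> //; exists v; split=> //.
have [_ _ dg1 _] := cp; have [_ _ dg' _] := cp'.
exact/same_flag_move.
Qed.

(** * Lifted motions and the intersection of $U_+$ with $TU_-$ *)

Section Birkhoff.

Definition borel_neg : set G := [set x | exists2 t, torus t & exists2 u, Uneg u & x = t * u].

Lemma borel_neg_torus x : torus x -> borel_neg x.
Proof. by move=> tx; exists x => //; exists 1; [exact: gen_one|rewrite mulg1]. Qed.

Lemma borel_neg_U b x : neg b -> U b x -> borel_neg x.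
Proof.
move=> nb ux; exists 1; first exact: torus1.
by exists x; [exact: genU_in ux|rewrite mul1g].
Qed.

Lemma borel_neg_group : is_subgroup borel_neg.
Proof.
split; first by apply: borel_neg_torus; exact: torus1.
- move=> _ _ [t tt [u uu ->]] [t' tt' [u' uu' ->]].
  exists (t * t'); first exact: torusM.
  exists (cj t'^-1 u * u'); last by rewrite /cj invgK !mulgA mulgK.
  by apply: gen_mul => //; apply: torus_Usgn => //; exact: torusV.
- move=> _ [t tt [u uu ->]]; exists t^-1; first exact: torusV.
  exists (cj t u^-1); last by rewrite invgM /cj !mulgA mulVg mul1g.
  by apply: torus_Usgn => //; exact: gen_inv.
Qed.

Lemma borel_neg_cj x u : borel_neg x -> Uneg u -> Uneg (cj x u).
Proof.
move=> [t tt [v uv ->]] uu; rewrite cjA; apply: torus_Usgn => //.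
by apply: gen_mul; [exact: gen_mul|exact: gen_inv].
Qed.

Definition same_chamber x y := borel_neg (x^-1 * y).

Lemma same_chamber_sym x y : same_chamber x y -> same_chamber y x.
Proof.
have [_ _ BV] := borel_neg_group.
by rewrite /same_chamber => /BV; rewrite invgM invgK.
Qed.

Lemma same_chamber_trans x y z : same_chamber x y -> same_chamber y z -> same_chamber x z.
Proof.
have [_ BM _] := borel_neg_group.
by move=> h1 h2; have := BM _ _ h1 h2; rewrite mulgA mulgK /same_chamber.
Qed.

Lemma same_chamber_mul z x y : same_chamber (z * x) (z * y) <-> same_chamber x y.
Proof. by rewrite /same_chamber invgM -mulgA mulKg. Qed.

Lemma same_chamber_lift v w : weq v w -> same_chamber (lift v) (lift w).
Proof. by move=> vw; apply: borel_neg_torus; exact: lift_torus. Qed.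

Definition chamber p := p.1 * lift p.2.

Lemma lower_low i w h : low_cell i w -> lower h -> borel_neg ((lift w)^-1 * phi i h * lift w).
Proof.
move=> lw /lowerE[t [r [t0 ->]]]; have [_ BM _] := borel_neg_group.
have E x : (lift w)^-1 * x * lift w = cj (lift w)^-1 x by rewrite /cj invgK.
rewrite E phiM // cjM; apply: BM.
  apply: (@borel_neg_U (weyl (rev w) (- al i))).
    by rewrite weylN; exact: neg_opp.
  by apply: liftVU; [apply: root_opp; exact: root_al|apply/U_NalP; exists r].
apply: borel_neg_torus => b rb; apply: conj_set_eq => x ux.
  rewrite !cjA invgK -[b](weylK D w); apply: liftVU; first exact: root_weyl.
  by apply: torus_U; [exact: phi_dg|exact: root_weyl|exact: liftU].
rewrite -cjV !cjA invgK -[b](weylK D w); apply: liftVU; first exact: root_weyl.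
by apply: torus_U; [apply: torusV; exact: phi_dg|exact: root_weyl|exact: liftU].
Qed.

Lemma chart_chamber i w y g p : chart i w y g p ->
  same_chamber (chamber p) (y * phi i g * lift w).
Proof.
rewrite /chamber => -[_ lw _ [r [h [-> lh gE]]]].
have lE : same_chamber (lift w) (phi i h * lift w).
  by rewrite /same_chamber mulgA; exact: lower_low.
case: gE => -[-> /same_chamber_lift xw]; have dh := proj1 lh; rewrite !phiM // !mulgA.
  rewrite -!mulgA !same_chamber_mul; exact: same_chamber_trans xw lE.
rewrite -!mulgA !same_chamber_mul; apply: same_chamber_trans xw _.
by rewrite lift_cons same_chamber_mul.
Qed.

Lemma step_chamber i h p q : step i h p q ->
  same_chamber (phi i h * chamber p) (chamber q).
Proof.
move=> [dh [w [y [g [cp cq]]]]]; have [_ _ dg1 _] := cp.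
apply: same_chamber_trans (same_chamber_sym (chart_chamber cq)).
have -> : cj (phi i h) y * phi i (h *m g) * lift w = phi i h * (y * phi i g * lift w).
  by rewrite phiM // /cj !mulgA mulgVK.
by apply/same_chamber_mul; exact: chart_chamber.
Qed.

(** Words in the lifted rank one actions. Each one covers a left translation of $G/B_-$
    ([motion_chamber]), but two motions over the same translation may differ. *)
Inductive motion : (point -> point -> Prop) -> Prop :=
| motion_id : motion (fun p q => p.1 = q.1 /\ weq q.2 p.2)
| motion_step i h : \det h = 1%R -> motion (step i h)
| motion_comp A B : motion A -> motion B -> motion (fun p q => exists2 z, A p z & B z q).

Lemma step_Upos i h p q : step i h p q -> Upos p.1 /\ Upos q.1.
Proof. by move=> [_ [w [y [g [/chart_Upos up /chart_Upos uq]]]]]. Qed.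

Lemma motion_total T : motion T -> forall p, Upos p.1 -> exists2 q, T p q & Upos q.1.
Proof.
elim=> [p up|i h dh p up|R S _ IR _ IS p up].
- by exists p.
- have [q pq] := step_total i dh up.
  by exists q => //; case: (step_Upos pq).
- by have [z pz /IS[q zq uq]] := IR p up; exists q => //; exists z.
Qed.

Lemma motion_near T : motion T -> forall e p p' q q', T p q -> T p' q' ->
  near e p p' -> near e q q'.
Proof.
elim=> [e [u v] [u' v'] [x w] [x' w'] /= [<- ww] [<- ww']|i h dh e p p' q q'|R S _ IR _ IS e p p' q q' [z pz zq] [z' pz' zq']].
- rewrite /near /= => -[h1 [s [h2 h3 h4]]]; split; first exact: wnear_weq ww' ww h1.
  by exists s; split=> //; exact: wnear_weq (weq_refl s) ww h2.
- exact: step_near.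
- by move=> /(IR _ _ _ _ _ pz pz')/(IS _ _ _ _ _ zq zq').
Qed.

Lemma motion_inv T : motion T -> exists2 T', motion T' & forall p q, T p q <-> T' q p.
Proof.
elim=> [|i h dh|R S _ [R' mR RE] _ [S' mS SE]].
- exists (fun p q => p.1 = q.1 /\ weq q.2 p.2); first exact: motion_id.
  by move=> p q; split=> -[-> e]; split=> //; exact: weq_sym.
- exists (step i (invmx h)); first by apply: motion_step; exact: det1V.
  by move=> p q; split=> /step_inv //; rewrite invmxK.
- exists (fun p q => exists2 z, S' p z & R' z q); first exact: motion_comp.
  move=> p q; split=> -[z h1 h2]; exists z; [exact/SE|exact/RE|exact/RE|exact/SE].
Qed.

Lemma motion_chamber T : motion T -> exists x, forall p q, T p q ->
  same_chamber (x * chamber p) (chamber q).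
Proof.
elim=> [|i h dh|R S _ [r RE] _ [s SE]].
- exists 1 => -[u v] [u' v'] /= [<- /weq_sym e]; rewrite mul1g; apply/same_chamber_mul.
  exact: same_chamber_lift.
- by exists (phi i h) => p q; exact: step_chamber.
- exists (s * r) => p q [z /RE pz /SE]; apply: same_chamber_trans.
  by rewrite -mulgA; apply/same_chamber_mul.
Qed.

Lemma step_nn i w w' : weq w' (i :: w) -> step i nn (1, w) (1, w').
Proof.
move=> ww; have [R1 _ _] := radical_group i.
have up1 : 1 = 1 * phi i (up 0%R) by rewrite up0 phi1 mulg1.
split=> //; case: (low_or i w) => lw.
  exists w, 1, 1%:M; rewrite cjg1 mulmx1; split; split; rewrite ?det1 //.
    exists 0%R, 1%:M; split=> //; first exact: lower1.
    by left; rewrite up0 mulmx1.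
  exists 0%R, 1%:M; split=> //; first exact: lower1.
  by right; rewrite up0 mulmx1 mul1mx.
(* The start now lies in the cell of [nn], and the target in the low cell because [nn *m nn] is
   minus the identity. *)
exists (i :: w), 1, nn; rewrite cjg1; split; split=> //.
  exists 0%R, 1%:M; split=> //; first exact: lower1.
  right; rewrite up0 mulmx1 mul1mx; split=> //; exact/weq_sym/weq_cons2.
exists 0%R, (nn *m nn); split=> //; last by left; rewrite up0 mul1mx.
by split=> //; rewrite mx2M mxE /=; ring.
Qed.

Lemma step_lo i r w : low_cell i w -> step i (lo r) (1, w) (1, w).
Proof.
move=> lw; have [R1 _ _] := radical_group i.
have up1 : 1 = 1 * phi i (up 0%R) by rewrite up0 phi1 mulg1.
split=> //; exists w, 1, 1%:M; rewrite cjg1 mulmx1; split; split; rewrite ?det1 //.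
  exists 0%R, 1%:M; split=> //; first exact: lower1.
  by left; rewrite up0 mulmx1.
exists 0%R, (lo r); split=> //; first exact: lower_lo.
by left; rewrite up0 mul1mx.
Qed.

(** In the projective line of the base panel, the group of the [lo] fixes the base chamber and is
    transitive on the rest; 1/r is the parameter that carries $s_iB_-$ to the chamber of [up r]. *)
Lemma step_fold i r w w' : r != 0%R -> weq w [:: i] -> weq w' [::] ->
  step i (lo r^-1) (1, w) (phi i (up r), w').
Proof.
move=> r0 ww ww'; have [R1 _ _] := radical_group i.
have up1 : 1 = 1 * phi i (up 0%R) by rewrite up0 phi1 mulg1.
split=> //; exists [::], 1, nn; rewrite cjg1; split; split=> //; try exact: pos_al.
  exists 0%R, 1%:M; split=> //; first exact: lower1.
  by right; rewrite up0 mulmx1 mul1mx.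
exists r, (mx2 r 0%R (-1)%R (r^-1)%R); split; first by rewrite mul1g.
  by split; [rewrite det_mx2 mulfV //; ring|rewrite mxE].
by left; split=> //; rewrite !mx2M; congr mx2; field.
Qed.

Lemma motion_lift w : exists2 T, motion T &
  forall v v', weq v' (w ++ v) -> T (1, v) (1, v').
Proof.
elim: w => [|i w [T mT TE]]; first by eexists; [exact: motion_id|].
exists (fun p q => exists2 z, T p z & step i nn z q).
  by apply: motion_comp => //; apply: motion_step.
by move=> v v' vv; exists (1, w ++ v); [exact: TE|exact: step_nn].
Qed.

Lemma near_sym e p q : near e p q -> near e q p.
Proof.
case: p q => u w [u' w']; rewrite /near /= => -[ww [v [vw vj fv]]].
have extK (x : seq 'I_n) : weq (extw e (extw e x)) x.
  by case: (e) => //= j a; rewrite !weyl_rcons reflK.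
have [_ _ VV] := chamber_fix_group v.
have ww2 : weq w w' \/ weq w (extw e w').
  case: ww => ww; [left; exact: weq_sym|right].
  apply: weq_sym; apply: weq_trans (weq_extw e ww) _; exact: extK.
split=> //; exists v; split=> //; last by have := VV _ fv; rewrite invgM invgK.
case: ww2 => ww2; case: vw => vw.
- by left; apply: weq_trans vw ww2.
- by right; apply: weq_trans vw (weq_extw e ww2).
- by right; apply: weq_trans vw ww2.
- by left; apply: weq_trans vw (weq_trans (weq_extw e ww2) (extK _)).
Qed.

Lemma chamber_fix_ext v w : weq v w -> chamber_fix v = chamber_fix w.
Proof. by move=> vw; rewrite /chamber_fix (inversions_ext vw). Qed.

(** The v in the definition of [near] is the longer of w and $ws_j$, whose inversion set contains
    that of the other. *)
Lemma chamber_fix_rcons j v w : weq v w \/ weq v (rcons w j) -> neg (weyl v (al j)) ->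
  chamber_fix w `<=` chamber_fix v.
Proof.
case=> vw nv; first by rewrite (chamber_fix_ext vw).
rewrite (chamber_fix_ext vw); apply: genU_sub => b [pb nb]; split=> //.
rewrite rev_rcons /=; apply: refl_neg => // e.
apply: (pos_neg pb); rewrite -(weylVK D w b) e -(refl_froot D j) -weyl_rcons -vw.
exact: nv.
Qed.

Lemma chamber_fix1 j x : chamber_fix [:: j] x -> exists r, x = phi j (up r).
Proof.
move=> h; apply/U_alP; move: x h; apply: genU_min; first exact/U_group/root_al.
move=> b x [pb /=] nb ux; have [<-//|bj] := pselect (b = al j).
by case: (pos_neg (refl_pos pb bj)).
Qed.

(* The orbits of the points (1, w) under the motions that fix the base point:
   a section of the covering of the negative building by the points. *)
Definition reached p := exists T x w,
  [/\ motion T, T (1, [::]) (1, [::]), chamber_fix w x & T (x, w) p].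

(** Pulling q back by T gives a point [(v', w')] adjacent to [(1, w)]. If w' is the longer chamber
    of the panel, this is the point [(1, w')]; if not, the motion is corrected by a fold of the base
    panel. *)
Lemma reached_near j p q : reached p -> near (Some j) p q -> Upos q.1 -> reached q.
Proof.
move=> [T [v [w [mT T1 fv Tp]]]] npq uq.
have [T' mT' TE] := motion_inv mT.
have [[v' w'] T'q uv'] := motion_total mT' uq.
have := motion_near mT' (proj1 (TE _ _) Tp) T'q npq.
rewrite /near /= => -[ww [u [wu uj fu]]].
have {}uj := uj j erefl.
have {}fu : chamber_fix u v'.
  rewrite -(mulVKg v v'); have [_ M _] := chamber_fix_group u; apply: M => //.
  exact: (chamber_fix_rcons wu uj).
have Tq : T (v', w') q by exact/TE.
have [uw'|uw'] : weq u w' \/ weq u (rcons w' j).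
  have wjj : weq (rcons (rcons w j) j) w by move=> a; rewrite !weyl_rcons reflK.
  have jj (x : seq 'I_n) : weq w' x -> weq (rcons w' j) (rcons x j) by exact: (@weq_extw (Some j)).
  case: ww => ww; case: wu => wu.
  - by left; apply: weq_trans wu (weq_sym ww).
  - by right; apply: weq_trans wu (weq_sym (jj _ ww)).
  - by right; apply: weq_trans wu (weq_sym (weq_trans (jj _ ww) wjj)).
  - by left; apply: weq_trans wu (weq_sym ww).
  by exists T, v', w'; rewrite -(chamber_fix_ext uw').
(* From here w' is the shorter chamber of its panel. The lift L of w' moves that panel to the base
   one, where only [al j] is an inversion, so the first coordinate becomes some [phi j (up r)]. *)
have pj : pos (weyl w' (al j)).
  by rewrite -[weyl _ _]opprK -weylN -(refl_froot D j) -weyl_rcons -uw'; exact: pos_opp.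
have [L mL LE] := motion_lift w'.
have [L' mL' LE'] := motion_inv mL.
have [[v2 w2] L'v uv2] := motion_total mL' (uv' : Upos (v', w').1).
have nv : near (Some j) (1, rcons w' j) (v', w').
  split=> /=; first by right=> a; rewrite !weyl_rcons reflK.
  by exists u; rewrite invg1 mul1g; split=> //; [left|move=> _ [<-]].
have Lj : L (1, [:: j]) (1, rcons w' j) by apply: LE; rewrite cats1.
have := motion_near mL' (proj1 (LE' _ _) Lj) L'v nv.
rewrite /near invg1 mul1g /= => -[wj [u2 [wu2 /(_ j erefl) nu2 fu2]]].
have {wu2} wu2 : weq u2 [:: j].
  case: wu2 => // wu2; case: (pos_neg (pos_al D j)).
  by have := nu2; rewrite wu2 /= reflK.
have [r v2E] : exists r, v2 = phi j (up r).
  by apply: chamber_fix1; rewrite -(chamber_fix_ext wu2).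
have Lq : L (v2, w2) (v', w') by exact/LE'.
have fixed (z : point) : near None z (v', w') -> chamber_fix z.2 z.1 -> reached q.
  rewrite /near => -[[|] /= ww' [s [[|] ws _ fs]] fz];
  exists T, v', w'; split=> //; rewrite (chamber_fix_ext ww');
  rewrite -(mulVKg z.1 v'); have [_ M _] := chamber_fix_group z.2; apply: M => //;
  by rewrite -(chamber_fix_ext ws).
have nearL (z w3 : seq 'I_n) : L (1, z) (1, w3) -> weq w2 z -> chamber_fix z v2 -> reached q.
  move=> Lz wz fz; apply: (fixed (1, w3)); last exact: gen_one.
  apply: (motion_near mL Lz Lq); split=> /=; first by left.
  by exists z; rewrite invg1 mul1g; split=> //; left.
case: wj => wj.
  by apply: nearL Lj wj _; rewrite -(chamber_fix_ext wu2).
have {}wj : weq w2 [::] by move=> a; rewrite wj /= reflK.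
have [r0|r0] := eqVneq r 0%R.
  apply: nearL (LE _ w' _) wj _; first by rewrite cats0.
  by rewrite v2E r0 up0 phi1; exact: gen_one.
have mS : motion (step j (lo r^-1)) by exact: motion_step.
(* The conjugate by L of the fold with parameter 1/r, followed by T; it takes the point of [w' ++
   [:: j]] to q. *)
exists (fun p q => exists2 z3, (exists2 z2, (exists2 z1, L' p z1 &
  step j (lo r^-1) z1 z2) & L z2 z3) & T z3 q), 1, (w' ++ [:: j]); split.
- by do 3!apply: motion_comp => //.
(* The base point is still fixed: L' carries it to [(1, rev w')], which [lo r^-1] fixes because
   $w'\alpha_j$ is positive. *)
- exists (1, [::]) => //; exists (1, rev w').
    exists (1, rev w'); first by apply/LE'; apply: LE => a; rewrite weyl_cat weylVK.
    by apply: step_lo; rewrite /low_cell revK.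
  by apply: LE => a; rewrite weyl_cat weylVK.
- exact: gen_one.
- exists (v', w') => //; exists (v2, w2) => //; exists (1, [:: j]).
    by apply/LE'; exact: LE.
  by rewrite v2E; apply: step_fold.
Qed.

Lemma reached_word x w : Upos x -> reached (x, [::]) <-> reached (x, w).
Proof.
move=> ux; elim/last_ind: w => [|w j IH]; first by [].
rewrite IH; have nn : near (Some j) (x, w) (x, rcons w j).
  split; first by right.
  have [h|h] := root_sign (root_weyl w (@root_al _ _ D j)).
    exists (rcons w j); rewrite mulVg; split; [by right| |exact: gen_one].
    by move=> _ [<-]; rewrite weyl_rcons refl_froot weylN; exact: neg_opp.
  exists w; rewrite mulVg; split; [by left| |exact: gen_one].
  by move=> _ [<-].
by split=> h; [exact: reached_near h nn ux|exact: reached_near h (near_sym nn) ux].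
Qed.

(** Multiplying by a generator x of [U b] with $b=w\alpha_k$ is invisible at the chamber $ws_k$,
    since b is an inversion there. [reached_word] carries the statement from the base chamber to
    $ws_k$ and back. *)
Lemma reached_Upos x : Upos x -> reached (x, [::]).
Proof.
suff H : forall x, Upos x -> forall y, Upos y -> reached (y, [::]) <-> reached (y * x, [::]).
  move=> ux; have [h _] := H x ux 1 (gen_one _); rewrite -(mul1g x); apply: h.
  exists (fun p q => p.1 = q.1 /\ weq q.2 p.2), 1, [::].
  by split=> //; [exact: motion_id|exact: gen_one].
move=> {}x ux.
suff : [set x | Upos x /\ forall y, Upos y -> reached (y, [::]) <-> reached (y * x, [::])] x.
  by case.
move: x ux; apply: genU_min.
  split.
  - by split=> [|y _]; [exact: gen_one|rewrite mulg1].
  - move=> x z [ux hx] [uz hz]; split=> [|y uy]; first exact: gen_mul.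
    by rewrite hx // hz ?mulgA //; exact: gen_mul.
  - move=> x [ux hx]; split=> [|y uy]; first exact: gen_inv.
    by rewrite [X in _ <-> X]hx ?mulgVK //; apply: gen_mul => //; exact: gen_inv.
move=> b x pb ub; have ux : Upos x by apply: genU_in ub.
split=> // y uy; have [[w [k bE]] _] := pb.
have uyx : Upos (y * x) by exact: gen_mul.
rewrite (reached_word (rcons w k) uy) (reached_word (rcons w k) uyx).
have nk : neg (weyl (rcons w k) (al k)).
  by rewrite weyl_rcons refl_froot weylN -bE; exact: neg_opp.
have nn : near (Some k) (y, rcons w k) (y * x, rcons w k).
  split; first by left.
  exists (rcons w k); rewrite mulKg; split; [by left|by move=> _ [<-]|].
  apply: genU_in ub; split=> //.
  by rewrite rev_rcons /= bE weylK refl_froot; apply: neg_opp; exact: pos_al.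
by split=> h; [exact: reached_near h nn uyx|exact: reached_near h (near_sym nn) uy].
Qed.

Hypothesis Uneg_proper : forall i, ~ (U (al i) `<=` Uneg).

(** A nontrivial w makes some fundamental root negative; as $TU_-$ normalizes $U_-$, that root group
    would lie in $U_-$. *)
Lemma lift_borel_neg w : borel_neg (lift w) -> weq w [::].
Proof.
move=> bw; apply: contrapT => /weylP[i nw]; apply: (@Uneg_proper i) => x ux.
rewrite -(cjK (lift w) x); apply: borel_neg_cj.
  by have [_ _ BV] := borel_neg_group; exact: BV.
by apply: genU_in nw _; apply: liftU => //; exact: root_al.
Qed.

Lemma chamber_fix_neg w x : chamber_fix w x -> Uneg (cj (lift w)^-1 x).
Proof.
apply: gen_cj => {}x [b [pb nb] ux]; apply: genU_in nb _.
by apply: liftVU => //; exact: pos_root.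
Qed.

(** The point [(x, [::])] is the image of some [(v, w)] under a motion fixing the base point. The
    translation below that motion lies in $B_-$, as does x, so [lift w] lies in $B_-$ and w and v
    are trivial. *)
Theorem Upos_borel_neg x : Upos x -> borel_neg x -> x = 1.
Proof.
move=> ux bx; have [T [v [w [mT T1 fv Tx]]]] := reached_Upos ux.
have [B1 BM BV] := borel_neg_group.
have [g0 gE] := motion_chamber mT.
have := gE _ _ T1; rewrite /same_chamber /chamber /= !lift_nil !mulg1 => /BV.
rewrite invgK => bg.
have := gE _ _ Tx; rewrite /same_chamber /chamber /= lift_nil mulg1 => /BV.
rewrite invgM invgK => bxv.
have bw : borel_neg (lift w).
  have -> : lift w = g0^-1 * (x * (x^-1 * (g0 * (v * lift w)))) * (cj (lift w)^-1 v)^-1.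
    by rewrite !mulVKg mulKg -cjV /cj invgK !mulgA mulgK mulgV mul1g.
  apply: (BM); last by apply: BV; exists 1; [exact: torus1|exists (cj (lift w)^-1 v);
    [exact: chamber_fix_neg|rewrite mul1g]].
  by apply: (BM); [exact: BV|exact: BM].
have w1 := lift_borel_neg bw; have v1 := chamber_fix_id w1 fv.
move: Tx; rewrite v1 => Tx.
(* The motion sends two names of the base point to [(1, [::])] and [(x, [::])]; these are therefore
   equal points, and $U_{(1)}$ is trivial. *)
have n0 : near None (1, [::]) (1, w).
  by split; [left|exists [::]; split=> //; [left|rewrite mulVg; exact: gen_one]].
have [/= _ [s [ws _ fs]]] := motion_near mT T1 Tx n0.
have {}ws : weq s [::] by case: ws.
by have := chamber_fix_id ws fs; rewrite invg1 mul1g.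
Qed.

End Birkhoff.

(** * The Iwasawa decomposition *)

Section Iwasawa.
Variables (sigma : F -> F) (theta : G -> G).
Hypothesis sigmaD : {morph sigma : r s / (r + s)%R}.
Hypothesis sigmaM : {morph sigma : r s / (r * s)%R}.
Hypothesis sigmaK : involutive sigma.
Hypothesis sigma_pos : forall r, r != 0%R -> (0 < r * sigma r)%R.
Hypothesis sigma_real : forall r, (0 < r)%R -> sigma r = r.
Hypothesis sqrt_pos : forall r, (0 < r)%R -> exists2 q : F, (0 < q)%R & (q ^+ 2 = r)%R.
Hypothesis Htheta : twisted_cartan_chevalley X sigma theta.

Let thM : {morph theta : x y / x * y} := thetaM Htheta.
Let thK : involutive theta := thetaK Htheta.

Lemma sigma0 : sigma 0%R = 0%R.
Proof. by apply: (addIr (sigma 0%R)); rewrite -sigmaD !add0r. Qed.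

Lemma sigma1 : sigma 1%R = 1%R.
Proof. exact: sigma_real ltr01. Qed.

Lemma sigmaN r : sigma (- r)%R = (- sigma r)%R.
Proof. by apply: (addIr (sigma r)); rewrite -sigmaD !addNr sigma0. Qed.

Lemma sigma_neq0 r : r != 0%R -> sigma r != 0%R.
Proof. by apply: contra_neq => r0; rewrite -(sigmaK r) r0 sigma0. Qed.

Lemma theta1 : theta 1 = 1.
Proof. by apply: (mulgI (theta 1)); rewrite -thM !mulg1. Qed.

Lemma thetaV x : theta x^-1 = (theta x)^-1.
Proof. by apply: (mulgI (theta x)); rewrite -thM !mulgV theta1. Qed.

Lemma theta_inj : injective theta.
Proof. exact: can_inj thK. Qed.

Lemma theta_root b x : root b -> U b x -> U (- b) (theta x).
Proof. by move=> rb ux; rewrite -(theta_U Htheta rb); exists x. Qed.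

Lemma theta_Usgn eps x : Usgn X eps x -> Usgn X (~~ eps) (theta x).
Proof.
move: x; apply: genU_min; first split.
- by rewrite /= theta1; exact: gen_one.
- by move=> x y ux uy; rewrite /= thM; exact: gen_mul.
- by move=> x ux; rewrite /= thetaV; exact: gen_inv.
move=> b x sb ux; apply: genU_in (theta_root (proj1 sb) ux).
by case: eps sb => [/neg_opp|/pos_opp].
Qed.

(** The root group datum states this for the other sign only; theta exchanges the two. *)
Lemma theta_Uneg_proper i : ~ (U (al i) `<=` Uneg).
Proof.
move=> h; apply: (U_proper (s0 := X) (i := i)) => y uy.
have /h /theta_Usgn : U (al i) (theta y).
  by rewrite -[al i]opprK; apply: theta_root => //; apply: root_opp; exact: root_al.
by rewrite thK.
Qed.

Definition posrow (a : 'rV[F]_m) := forall k, (0 < a 0%R k)%R.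

Lemma posrow_pt (a : 'rV[F]_m) : posrow a -> torus_pt a.
Proof. by move=> pa k; rewrite gt_eqF. Qed.

Lemma torus_pt_mul (a b : 'rV[F]_m) : torus_pt a -> torus_pt b -> torus_pt (torus_mul a b).
Proof. by move=> pa pb k; rewrite mxE mulf_neq0. Qed.

Lemma torus_pt_sigma (a : 'rV[F]_m) : torus_pt a -> torus_pt (map_mx sigma a).
Proof. by move=> pa k; rewrite mxE sigma_neq0. Qed.

Lemma eta_torus (a : 'rV[F]_m) : torus_pt a -> torus (eta X a).
Proof. by move=> pa; apply/torusP; exists a. Qed.

Lemma theta_eta (a : 'rV[F]_m) : torus_pt a -> theta (eta X a) = (eta X (map_mx sigma a))^-1.
Proof.
move=> pa; have [s hs [_ ht]] := theta_sigma Htheta.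
by rewrite ht; [rewrite (field_aut_eta hs)|exact: eta_torus].
Qed.

Lemma theta_torus x : torus x -> torus (theta x).
Proof.
move=> /torusP[a pa ->]; rewrite theta_eta //; apply: torusV; apply: eta_torus.
exact: torus_pt_sigma.
Qed.

Let A : set G := [set t * (theta t)^-1 | t in torus].

(** On the torus $t\theta(t)^{-1}=t\sigma(t)$ has positive entries, and a positive row is the image
    of its entrywise square root. *)
Lemma split_torusE x : A x <-> exists2 a, posrow a & x = eta X a.
Proof.
split=> [[_ /torusP[a pa ->] <-]|[a pa ->]].
  rewrite theta_eta // invgK -etaM //; last exact: torus_pt_sigma.
  by eexists; last reflexivity; move=> k; rewrite !mxE sigma_pos.
have qex k : exists q : F, (0 < q)%R /\ (q ^+ 2 = a 0%R k)%R.
    by have [q q0 qE] := sqrt_pos (pa k); exists q.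
  have [q qE] := choice qex.
have pq : torus_pt (\row_k q k).
  by move=> k; rewrite mxE gt_eqF //; case: (qE k).
exists (eta X (\row_k q k)); first exact: eta_torus.
rewrite theta_eta // invgK -etaM //; last exact: torus_pt_sigma.
congr (eta X _); apply/rowP => k; rewrite !mxE; have [q0 <-] := qE k.
by rewrite sigma_real // expr2.
Qed.

Lemma theta_split x : A x -> theta x = x^-1.
Proof.
move=> /split_torusE[a pa ->]; rewrite theta_eta; last exact: posrow_pt.
by congr (eta X _)^-1; apply/rowP => k; rewrite mxE sigma_real.
Qed.

Lemma split_torus x : A x -> torus x.
Proof. by move=> /split_torusE[a /posrow_pt pa ->]; exact: eta_torus. Qed.

Lemma split_square x y : A x -> A y -> x * x = y * y -> x = y.
Proof.
move=> /split_torusE[a pa ->] /split_torusE[b pb ->].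
have ta := posrow_pt pa; have tb := posrow_pt pb.
rewrite -!etaM // => /(eta_inj (torus_pt_mul ta ta) (torus_pt_mul tb tb)) /rowP e.
congr (eta X _); apply/rowP => k; have := e k; rewrite !mxE -!expr2 => /eqP.
by rewrite eqrXn2 // ?ltW // => /eqP.
Qed.

(** Entrywise polar form: dividing t by the root q of $t\sigma(t)$ leaves p with $p\sigma(p)=1$, the
    condition for theta to fix [eta X p]. *)
Lemma torus_polar x : torus x -> exists y z, [/\ theta y = y, A z & x = y * z].
Proof.
move=> /torusP[t pt ->].
have qex k : exists q : F, (0 < q)%R /\ (q ^+ 2 = t 0%R k * sigma (t 0%R k))%R.
  by have [q q0 qE] := sqrt_pos (sigma_pos (pt k)); exists q.
have [q qE] := choice qex.
have q0 k : q k != 0%R by rewrite gt_eqF //; case: (qE k).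
have pq : posrow (\row_k q k) by move=> k; rewrite mxE; case: (qE k).
pose p : 'rV[F]_m := \row_k (t 0%R k / q k)%R.
have pp : torus_pt p by move=> k; rewrite mxE mulf_neq0 ?invr_neq0.
exists (eta X p), (eta X (\row_k q k)); split; last first.
- rewrite -etaM //; last exact: posrow_pt.
  by congr (eta X _); apply/rowP => k; rewrite !mxE divfK.
- by apply/split_torusE; exists (\row_k q k).
rewrite theta_eta //; apply: (mulgI (eta X (map_mx sigma p))).
rewrite mulgV -etaM //; last exact: torus_pt_sigma.
have pt1 : torus_pt (const_mx 1%R : 'rV[F]_m) by move=> k; rewrite mxE oner_eq0.
have <- : eta X (const_mx 1%R) = 1.
  apply: (mulgI (eta X (const_mx 1%R))); rewrite -etaM // mulg1; congr (eta X _).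
  by apply/rowP => k; rewrite !mxE mulr1.
congr (eta X _); apply/rowP => k; rewrite !mxE; have [qk qqk] := qE k.
have -> : sigma (t 0%R k / q k) = (sigma (t 0%R k) / q k)%R.
  apply: (mulIf (q0 k)); rewrite divfK // -{2}(sigma_real qk) -sigmaM divfK //.
by rewrite mulrACA -invfM -expr2 qqk [X in (X / _)%R]mulrC divff // mulf_neq0 ?sigma_neq0.
Qed.

Lemma theta_phi i : exists2 e : F, (0 < e)%R & forall a b c d : F, (a * d - b * c = 1)%R ->
  theta (phi i (mx2 a b c d)) =
  phi i (mx2 (sigma d) (- (sigma c / e)) (- (e * sigma b)) (sigma a))%R.
Proof.
have [s hs [hp _]] := theta_sigma Htheta; have [e e0 he] := hp [::] i.
exists e => // a b c d det.
have det' : (sigma a * sigma d - sigma b * sigma c = 1)%R.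
  by rewrite -!sigmaM -sigmaN -sigmaD det sigma1.
have := he (mx2 (sigma a) (sigma b) (sigma c) (sigma d)).
rewrite det_mx2 /pinning lift_nil invg1 !mulg1 !mul1g => /(_ det') /=.
rewrite (field_aut_phi hs) ?det_mx2 //.
have -> : map_mx sigma (mx2 (sigma a) (sigma b) (sigma c) (sigma d)) = mx2 a b c d.
  by apply/matrixP => -[[|[|//]] p] [[|[|//]] q]; rewrite !mxE /= sigmaK.
move=> ->; congr (phi i _); rewrite mx2T invmx_mx2; last by rewrite -det'; ring.
have en : e != 0%R by rewrite gt_eqF.
by rewrite !mx2M; congr mx2; field.
Qed.

(** Gram-Schmidt for the form $x\sigma(x)+y\sigma(y)/e$, definite because e > 0: q is the norm of
    the first column of g, r the product of its two columns, and k has the normalized first column,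
    completed so that theta fixes it. *)
Lemma iwasawa_SL2 i g : \det g = 1%R -> exists k (r q : F), [/\ \det k = 1%R,
  theta (phi i k) = phi i k, q != 0%R & g = k *m up r *m dg q].
Proof.
have [e e0 te] := theta_phi i; have en : e != 0%R by rewrite gt_eqF.
rewrite (mx2P g) det_mx2.
move: (g 0%R 0%R) (g 0%R 1%R) (g 1%R 0%R) (g 1%R 1%R) => {g} a b c d det.
have N0 : (0 < a * sigma a + c * sigma c / e)%R.
  have sq (r : F) : (0 <= r * sigma r)%R.
    by have [->|r0] := eqVneq r 0%R; [rewrite mul0r|rewrite ltW ?sigma_pos].
  have [a0|a0] := eqVneq a 0%R.
    have c0 : c != 0%R.
      by apply/eqP => c0; move/eqP: det; rewrite a0 c0 mul0r mulr0 subr0 eq_sym oner_eq0.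
    by rewrite ltr_wpDl // divr_gt0 // sigma_pos.
  by rewrite ltr_pwDl // ?sigma_pos // divr_ge0 // ltW.
have [q q0 qE] := sqrt_pos N0; have qn : q != 0%R by rewrite gt_eqF.
have sq : sigma q = q by exact: sigma_real.
have se : sigma e = e by exact: sigma_real.
have sV (r : F) : r != 0%R -> sigma r = r -> sigma r^-1%R = r^-1%R.
  move=> r0 sr; apply: (mulIf r0); rewrite mulVf // -{2}sr -sigmaM mulVf //.
  exact: sigma1.
pose k := mx2 (a / q)%R (- (sigma c / (e * q)))%R (c / q)%R (sigma a / q)%R.
have dk : (a / q * (sigma a / q) - - (sigma c / (e * q)) * (c / q) = 1)%R.
  have -> : (1 = (a * sigma a + c * sigma c / e) / q ^+ 2)%R by rewrite qE divff // gt_eqF.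
  by field; rewrite qn en.
exists k, ((sigma a * b + sigma c * d / e))%R, q; split=> //.
- by rewrite det_mx2.
- rewrite te // !sigmaM sigmaN !sigmaM sigmaK (sV q) // (sV (e * q)%R) ?mulf_neq0 //;
    last by rewrite sigmaM se sq.
  by rewrite sigmaK; congr (phi i (mx2 _ _ _ _)); field; rewrite ?qn ?en.
set r := (_ + _)%R.
have bE : (b * q ^+ 2 = a * r - sigma c / e * (a * d - b * c))%R by rewrite qE /r; field.
have dE : (d * q ^+ 2 = c * r + sigma a * (a * d - b * c))%R by rewrite qE /r; field.
rewrite det !mulr1 in bE dE; have q2 : (q ^+ 2 != 0)%R by rewrite expf_neq0.
rewrite /k !mx2M; congr mx2.
- by field; rewrite qn en.
- by apply: (mulIf q2); rewrite bE; field; rewrite qn en.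
- by field; rewrite qn.
- by apply: (mulIf q2); rewrite dE; field; rewrite qn.
Qed.

Definition iwasawa_cell : set G :=
  [set x | exists k t u : G, [/\ theta k = k, torus t, Upos u & x = k * t * u]].

Lemma cell_torus x (t : G) : iwasawa_cell x -> torus t -> iwasawa_cell (x * t).
Proof.
move=> [k [t' [u [hk tt' uu ->]]]] tt; exists k, (t' * t), (cj t^-1 u); split=> //.
- exact: torusM.
- by apply: torus_Usgn => //; exact: torusV.
- by rewrite /cj invgK !mulgA mulgK.
Qed.

Lemma cell_up i x r : iwasawa_cell x -> iwasawa_cell (x * phi i (up r)).
Proof.
move=> [k [t [u [hk tt uu ->]]]]; exists k, t, (u * phi i (up r)); split=> //.
  by apply: gen_mul => //; exact: phi_up_Upos.
by rewrite !mulgA.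
Qed.

(** The radical part of u is moved past the i-th $\mathrm{SL}_2$, which normalizes the radical; the
    rest is a rank one element, up to t, and [iwasawa_SL2] applies. *)
Lemma cell_lo i x r : iwasawa_cell x -> iwasawa_cell (x * phi i (lo r)).
Proof.
move=> [k [t [_ [hk tt /(Upos_radical i)[y [s [ry ->]]] ->]]]].
have [s' sE] : exists s', cj t (phi i (up s)) = phi i (up s').
  by apply/U_alP; apply: torus_U => //; [exact: root_al|apply/U_alP; exists s].
have [r' rE] : exists r', cj t (phi i (lo r)) = phi i (lo r').
  apply/U_NalP; apply: torus_U => //; last by apply/U_NalP; exists r.
  by apply: root_opp; exact: root_al.
have [h [r2 [q [dh hK q0 gE]]]] := @iwasawa_SL2 i (up s' *m lo r') (det1M (det_up _) (det_lo _)).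
have ry' : radical i (cj (phi i (up s *m lo r))^-1 y) by apply: radical_cjV.
have tE : t * phi i (up s *m lo r) = phi i h * phi i (up r2) * phi i (dg q) * t.
  by rewrite mul_cj phiM // cjM sE rE -!phiM // -?gE; auto.
have -> : k * t * (y * phi i (up s)) * phi i (lo r) =
    k * (t * phi i (up s *m lo r)) * cj (phi i (up s *m lo r))^-1 y.
  by rewrite /cj invgK -!mulgA mulVKg phiM.
rewrite tE.
exists (k * phi i h), (phi i (dg q) * t),
  (cj (phi i (dg q) * t)^-1 (phi i (up r2)) * cj (phi i (up s *m lo r))^-1 y).
have tq : torus (phi i (dg q) * t) by apply: torusM => //; exact: phi_dg.
split=> //; first by rewrite thM hk hK.
- apply: gen_mul; last exact: radical_Upos ry'.
  by apply: torus_Usgn; [exact: torusV|exact: phi_up_Upos].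
- by move: (cj _ y) => z; rewrite /cj invgK invgM !mulgA !mulgK.
Qed.

Lemma cell_lift i x : iwasawa_cell x ->
  iwasawa_cell (x * phi i nn) /\ iwasawa_cell (x * (phi i nn)^-1).
Proof.
move=> cx; split.
  by rewrite nnE !phiM // !mulgA; apply: cell_up; apply: cell_lo; exact: cell_up.
have -> : (phi i nn)^-1 = phi i (up (-1)) * phi i (lo 1) * phi i (up (-1)).
  by rewrite -phiV // -!phiM // invmx_nn !mx2M; congr (phi i (mx2 _ _ _ _)); ring.
by rewrite !mulgA; apply: cell_up; apply: cell_lo; exact: cell_up.
Qed.

Lemma cell_lift_word w x : iwasawa_cell x ->
  iwasawa_cell (x * lift w) /\ iwasawa_cell (x * (lift w)^-1).
Proof.
elim: w x => [|i w IH] x cx; first by rewrite lift_nil invg1 mulg1.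
rewrite lift_cons invgM !mulgA; split.
  by case: (IH _ (proj1 (cell_lift i cx))).
by case: (cell_lift i (proj2 (IH _ cx))).
Qed.

Lemma cell_U a x y : root a -> U a y -> iwasawa_cell x -> iwasawa_cell (x * y).
Proof.
move=> [w [i ->]] uy cx.
have : U (al i) (cj (lift w)^-1 y).
  by rewrite -[al i](weylK D w); apply: liftVU => //; apply: root_weyl; exact: root_al.
move=> /U_alP[r rE].
have -> : x * y = x * lift w * phi i (up r) * (lift w)^-1.
  by rewrite -rE /cj invgK !mulgA !mulgK.
by case: (cell_lift_word w (cell_up i r (proj1 (cell_lift_word w cx)))).
Qed.

Lemma cell_full x : iwasawa_cell x.
Proof.
suff H : forall y, iwasawa_cell y -> iwasawa_cell (y * x) /\ iwasawa_cell (y * x^-1).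
  have c1 : iwasawa_cell 1.
    exists 1, 1, 1; rewrite !mulg1; split=> //; [exact: theta1|exact: torus1|exact: gen_one].
  by rewrite -(mul1g x); case: (H 1 c1).
have : [set: G] x by [].
rewrite -(G_generated X); elim=> {x} [x [[t pt <-]|[a ra ux]]||x y _ hx _ hy|x _ hx] z cz.
- have tt := eta_torus pt.
  by split; apply: cell_torus => //; exact: torusV.
- split; apply: (cell_U ra _ cz) => //.
  by have [_ _ UV] := U_group ra; exact: UV.
- by rewrite invg1 mulg1.
- rewrite invgM !mulgA; split.
    by case: (hy _ (proj1 (hx _ cz))).
  by case: (hx _ (proj2 (hy _ cz))).
- by rewrite invgK; case: (hx _ cz).
Qed.

Lemma iwasawa_exists x : exists k a u : G, [/\ theta k = k, A a, Upos u & x = k * a * u].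
Proof.
have [k [t [u [hk tt uu ->]]]] := cell_full x.
have [p [a [hp Aa ->]]] := torus_polar tt.
by exists (k * p), a, u; rewrite !mulgA thM hk hp.
Qed.

(** With $v=u'u^{-1}$, theta fixes $k'^{-1}k=a'va^{-1}$ and inverts A, so $\theta(v)=a'^2va^{-2}$.
    Once v = 1 this reads $a'^2=a^2$, and positive square roots are unique. *)
Lemma iwasawa_unique (k a u k' a' u' : G) : theta k = k -> A a -> Upos u ->
  theta k' = k' -> A a' -> Upos u' -> k * a * u = k' * a' * u' ->
  [/\ k = k', a = a' & u = u'].
Proof.
move=> hk Aa uu hk' Aa' uu' e.
have [v vE] : exists v : G, v = u' * u^-1 by exists (u' * u^-1).
have uv : Upos v by rewrite vE; apply: gen_mul => //; exact: gen_inv.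
have ta := split_torus Aa; have ta' := split_torus Aa'.
have kE : k'^-1 * k = a' * v * a^-1.
  apply: (mulIg (a * u)); rewrite -!mulgA (mulgA k) e.
  by rewrite vE -!mulgA !mulKg mulVg mulg1.
have fixk : theta (a' * v * a^-1) = a' * v * a^-1.
  by rewrite -kE thM thetaV hk hk'.
have thv : theta v = a' * a' * v * a^-1 * a^-1.
  move: fixk; rewrite !thM thetaV (theta_split Aa) (theta_split Aa') invgK => fixk.
  apply: (mulgI a'^-1); apply: (mulIg a); rewrite fixk.
  by rewrite !mulgA mulVg mul1g mulgVK.
have v1 : v = 1.
  apply: (Upos_borel_neg theta_Uneg_proper uv).
  have -> : v = theta (a' * a' * a^-1 * a^-1) * theta (cj (a * a) v).
    by rewrite -thM /cj invgM -[LHS]thK thv !mulgA !mulgVK.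
  exists (theta (a' * a' * a^-1 * a^-1)).
    by apply: theta_torus; do 3?apply: torusM => //; exact: torusV.
  exists (theta (cj (a * a) v)) => //; apply: (@theta_Usgn true).
  by apply: torus_Usgn => //; exact: torusM.
have ee : a' * a' = a * a.
  move: thv; rewrite v1 theta1 mulg1 => h.
  by apply: (mulIg a^-1); apply: (mulIg a^-1); rewrite -h mulgK mulgV.
have aa := split_square Aa' Aa ee; subst a'.
have uE : u' = u by apply: (mulIg u^-1); rewrite mulgV -vE.
split=> //; apply: (mulIg (a * u)); rewrite !mulgA e uE //.
Qed.

Lemma split_torusV x : A x -> A x^-1.
Proof.
move=> [t tt <-]; exists (theta t); first exact: theta_torus.
by rewrite thK invgM invgK.
Qed.

Lemma iwasawa_bij eps :
  set_bij ([set g : G | theta g = g] `*` A `*` Usgn X eps) [set: G]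
    (fun p : G * G * G => p.1.1 * p.1.2 * p.2).
Proof.
case: eps; split=> //.
- move=> [[k a] u] [[k' a'] u'] /set_mem[[/= hk Aa] uu] /set_mem[[/= hk' Aa'] uu'] e.
  by have [-> -> ->] := iwasawa_unique hk Aa uu hk' Aa' uu' e.
- move=> x _; have [k [a [u [hk Aa uu ->]]]] := iwasawa_exists x.
  by exists (k, a, u).
- move=> [[k a] u] [[k' a'] u'] /set_mem[[/= hk Aa] uu] /set_mem[[/= hk' Aa'] uu'].
  move=> /(congr1 theta); rewrite /= !thM hk hk' (theta_split Aa) (theta_split Aa') => e.
  have [-> /invg_inj -> /theta_inj -> //] := iwasawa_unique hk (split_torusV Aa)
    (theta_Usgn uu) hk' (split_torusV Aa') (theta_Usgn uu') e.
- move=> x _; have [k [a [u [hk Aa uu e]]]] := iwasawa_exists (theta x).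
  exists (k, a^-1, theta u) => /=.
    by split=> /=; [split=> //=; exact: split_torusV|exact: (theta_Usgn uu)].
  by rewrite -(theta_split Aa) -{1}hk -!thM -e thK.
Qed.

End Iwasawa.

End KacMoodyGroup.

(** * The real and complex ground fields *)

Section Ground.
Variables (R : realType) (k : ground).
Local Notation F := (ground_field R k).
Local Notation sigma := (@ground_conj R k).
Implicit Types r s : F.

Lemma ground_conjD : {morph sigma : r s / r + s}.
Proof. by case: k => //= r s; rewrite rmorphD. Qed.

Lemma ground_conjM : {morph sigma : r s / r * s}.
Proof. by case: k => //= r s; rewrite rmorphM. Qed.

Lemma ground_conjK : involutive sigma.
Proof. by case: k => //= r; exact: conjcK. Qed.

Lemma ground_conj_pos r : r != 0 -> 0 < r * sigma r.
Proof.
case: k r => /= [r r0|[a b]]; first by rewrite lt0r mulf_neq0 //= -expr2 sqr_ge0.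
rewrite eq_complex /= negb_and ltcE /= => ab.
apply/andP; split; first by apply/eqP; ring.
rewrite mulrN opprK -!expr2; case/orP: ab => h.
  by rewrite ltr_pwDl ?sqr_ge0 // lt0r sqrf_eq0 h sqr_ge0.
by rewrite ltr_wpDl ?sqr_ge0 // lt0r sqrf_eq0 h sqr_ge0.
Qed.

Lemma ground_conj_real r : 0 < r -> sigma r = r.
Proof. by case: k r => //= -[a b]; rewrite ltcE /= => /andP[/eqP -> _]; rewrite oppr0. Qed.

Lemma ground_sqrt r : 0 < r -> exists2 q : F, 0 < q & q ^+ 2 = r.
Proof.
case: k r => /= [r r0|[a b]].
  by exists (Num.sqrt r); rewrite ?sqrtr_gt0 // sqr_sqrtr // ltW.
rewrite ltcE /= => /andP[/eqP -> a0].
exists (real_complex R (Num.sqrt a)); first by rewrite ltcE /= eqxx sqrtr_gt0.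
by rewrite -rmorphXn /= sqr_sqrtr // ltW.
Qed.

End Ground.

Theorem proposition3p4 (R : realType) (k : ground) (G : groupType) (n m : nat)
    (D : km_datum n m) (X : split_km (ground_field R k) G D) (theta : G -> G)
    (Htheta : twisted_cartan_chevalley X (@ground_conj R k) theta) :
  let K := [set g : G | theta g = g] in
  let A := [set (t * (theta t)^-1)%g | t in torus X] in
  forall eps : bool,
    set_bij (K `*` A `*` Usgn X eps) [set: G]
      (fun p : G * G * G => (p.1.1 * p.1.2 * p.2)%g).
Proof.
move=> K A eps; apply: (iwasawa_bij _ _ _ _ _ _ Htheta).
- exact: ground_conjD.
- exact: ground_conjM.
- exact: ground_conjK.
- exact: ground_conj_pos.
- exact: ground_conj_real.
- exact: ground_sqrt.
Qed.
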